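(* Let $0<T_{min}\le T_{max}<\infty$ be given. Then the following statements are equivalent: (a) There exist matrices $P_i\in\mathbb{S}^{n+m}_{\succ0}$, $K_i\in\mathbb{R}^{m\times(n+m)}$, $i=1,\ldots,N$, a nonnegative matrix $\Pi=[\pi_{ij}]\in\mathbb{R}^{N\times N}$ verifying $\mathbf{1}_N^T\Pi=\mathbf{1}_N^T$ and a scalar $\varepsilon>0$ such that, with $\bar J_i=\bar J_i^0+\bar J_i^1K_i$, $$\bar J_i^Te^{\bar A^T\theta}\left(\sum_{j=1}^N\pi_{ji}P_j\right)e^{\bar A\theta}\bar J_i-P_i+\varepsilon I\preceq0$$ holds for all $i=1,\ldots,N$ and all $\theta\in[T_{min},T_{max}]$. (b) There exist scalars $\varepsilon>0$ and $d\in\mathbb{Z}_{\ge0}$ such that the following sum of squares program is feasible using polynomial matrices of degree (at most) $2d$: find symmetric matrix-valued polynomial functions $\tilde S_i,\Gamma_i,\Delta_i:\mathbb{R}\to\mathbb{S}^{n+m}$, constant matrices $\tilde P_i\in\mathbb{S}^{n+m}$ and $U_i\in\mathbb{R}^{m\times(n+m)}$, $i=1,\ldots,N$, and a nonnegative matrix $\Pi=[\pi_{ij}]\in\mathbb{R}^{N\times N}$ with $\mathbf{1}_N^T\Pi=\mathbf{1}_N^T$ such that, for all $i=1,\ldots,N$: - $\Gamma_i(\cdot)$ and $\Delta_i(\cdot)$ are SOS matrices, - $\tilde P_i-\varepsilon I$ is an SOS matrix, - $-\dot{\tilde S}_i(\tau)-\big(\tilde S_i(\tau)\bar A^T+\bar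 A\tilde S_i(\tau)\big)-\Gamma_i(\tau)g(\tau)$ is an SOS matrix (in $\tau$), - $\begin{bmatrix}\tilde P_i-\varepsilon I&(\bar J_i^0\tilde P_i+\bar J_i^1U_i)^T\\ \bar J_i^0\tilde P_i+\bar J_i^1U_i&\tilde S_i(\theta)-\Delta_i(\theta)h(\theta)\end{bmatrix}$ is an SOS matrix (in $\theta$), - $\operatorname{diag}_{j=1}^N\{\tilde P_j\}-V_i\tilde S_i(0)V_i^T$ is an SOS matrix, where $V_i=\operatorname{col}_{j=1}^N\{\pi_{ji}^{1/2}I_{n+m}\}$.
   Context: $\mathbb{S}^{q}$ is the set of real symmetric $q\times q$ matrices, $\mathbb{S}^{q}_{\succ0}$ the positive definite ones; $X\preceq0$ means negative semidefinite. $\mathbf{1}_N$ is the $N$-vector of ones. A nonnegative matrix is a matrix with nonnegative entries. $\operatorname{diag}_{j=1}^N\{X_j\}$ is the block-diagonal matrix with blocks $X_1,\ldots,X_N$ and $\operatorname{col}_{j=1}^N\{X_j\}$ is the block column obtained by stacking $X_1,\ldots,X_N$. A dot denotes differentiation with respect to the argument. Data: integers $n,m,N\ge1$, real matrices $A\in\mathbb{R}^{n\times n}$, $B\in\mathbb{R}^{n\times m}$, $J_i\in\mathbb{R}^{n\times n}$, $i=1,\ldots,N$, and $$\bar A=\begin{bmatrix}A&B\\ 0&0\end{bmatrix},\qquad \bar J_i^0=\begin{bmatrix}J_i&0\\ 0&0\end{bmatrix},\qquad \bar J_i^1=\begin{bmatrix}0\\ I_m\end{bmatrix}.$$ The polynomials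 $g,h$ are $$g(\tau):=\tau(T_{max}-\tau),\qquad h(\theta):=(\theta-T_{min})(T_{max}-\theta).$$ A symmetric (univariate, real) polynomial matrix $\Theta(\cdot)$ is called a sum of squares (SOS) matrix if there exists a (not necessarily square) polynomial matrix $\Xi(\cdot)$ such that $\Theta(\cdot)=\Xi(\cdot)^T\Xi(\cdot)$; a constant matrix is regarded as a polynomial matrix of degree zero. ''Using polynomial matrices of degree (at most) $2d$'' refers to the unknown polynomial matrices $\tilde S_i,\Gamma_i,\Delta_i$. *)

(* Defs.v *)
From HB Require Import structures.
From mathcomp Require Import all_boot all_order all_algebra.
From mathcomp Require Import all_classical all_reals all_analysis.
Import Order.TTheory GRing.Theory Num.Theory.
Import numFieldNormedType.Exports.

Set Implicit Arguments.
Unset Strict Implicit.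
Unset Printing Implicit Defensive.

Local Open Scope classical_set_scope.
Local Open Scope ring_scope.

Definition posdefmx (R : realType) (q : nat) (X : 'M[R]_q) : Prop :=
  X^T = X /\ forall v : 'cV[R]_q, v != 0 -> 0 < (v^T *m X *m v) 0 0.

Definition negsemidefmx (R : realType) (q : nat) (X : 'M[R]_q) : Prop :=
  X^T = X /\ forall v : 'cV[R]_q, (v^T *m X *m v) 0 0 <= 0.

(* The limit is taken in the product (entrywise) topology of 'M[R]_q. *)
Definition expmx (R : realType) (q : nat) (X : 'M[R]_q) : 'M[R]_q :=
  limn (series (fun k : nat => (k`!%:R)^-1 *: X ^+ k)).

(* A real polynomial matrix is an element of 'M[{poly R}]_(p, q), i.e. it is
   identified with the polynomial function it induces; this is harmless since
   R is infinite. *)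

Definition constpmx (R : realType) (p q : nat) (X : 'M[R]_(p, q)) :
  'M[{poly R}]_(p, q) := map_mx (@polyC R) X.

Definition evalpmx (R : realType) (p q : nat) (X : 'M[{poly R}]_(p, q))
  (x : R) : 'M[R]_(p, q) := map_mx (fun f : {poly R} => f.[x]) X.

Definition derivpmx (R : realType) (p q : nat) (X : 'M[{poly R}]_(p, q)) :
  'M[{poly R}]_(p, q) := map_mx (@deriv R) X.

Definition degpmx_le (R : realType) (p q : nat) (k : nat)
  (X : 'M[{poly R}]_(p, q)) : Prop := forall i j, (size (X i j) <= k.+1)%N.

Definition SOSmx (R : realType) (q : nat) (X : 'M[{poly R}]_q) : Prop :=
  exists (r : nat) (Xi : 'M[{poly R}]_(r, q)), X = Xi^T *m Xi.

Definition Abar (R : realType) (n m : nat) (A : 'M[R]_n) (B : 'M[R]_(n, m)) :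
  'M[R]_(n + m) := block_mx A B 0 0.

Definition Jbar0 (R : realType) (n m : nat) (J : 'M[R]_n) : 'M[R]_(n + m) :=
  block_mx J 0 0 0.

Definition Jbar1 (R : realType) (n m : nat) : 'M[R]_(n + m, m) :=
  col_mx 0 1%:M.

Definition gpoly (R : realType) (Tmax : R) : {poly R} := 'X * (Tmax%:P - 'X).

Definition hpoly (R : realType) (Tmin Tmax : R) : {poly R} :=
  ('X - Tmin%:P) * (Tmax%:P - 'X).

Definition col_stochastic (R : realType) (N : nat) (Pi : 'M[R]_N) : Prop :=
  (forall i j, 0 <= Pi i j) /\
  const_mx 1 *m Pi = const_mx 1 :> 'rV[R]_N.

Definition Vmx (R : realType) (N q : nat) (Pi : 'M[R]_N) (i : 'I_N) :
  'M[R]_(\sum_(j < N) q, q) := \mxcol_(j < N) ((Num.sqrt (Pi j i))%:M : 'M[R]_q).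

(* Main.v *)
(* (b) => (a): with P_i the inverse of P~_i and Q_i = sum_j pi_ji P_j, the flow
   inequality makes e^(At) S_i(t) e^(A^T t) nonincreasing, and the last
   constraint gives Q_i S_i(0) Q_i <= Q_i; hence X = e^(A^T t) Q_i e^(At) satisfies
   X S_i(t) X <= X, which turns the block inequality into the LMI of (a).  No
   invertibility of S_i is needed.

   (a) => (b): with P~_i = P_i^-1, take S_i(t) = (1 - delta t) E Q_i^-1 E^T,
   where the polynomial matrix E is a Taylor section of e^(-At).  For delta small
   and E accurate, all the inequalities of (b) hold strictly on the relevant intervals,
   and a matrix polynomial that is positive definite on [a, b] has the form
   S0 + (t - a)(b - t) S1 with S0, S1 SOS, because its Bernstein coefficients of
   high degree are positive definite.  Since only the lower right block gets a
   multiplier, this is applied to the Schur complement.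

   Matrix exponentials are only handled through their Taylor sections, whose
   derivatives are polynomial, so that the mean value theorem for polynomials
   suffices. *)
Require Import Defs.
From HB Require Import structures.
From mathcomp Require Import all_boot all_order all_algebra.
From mathcomp Require Import all_classical all_reals all_analysis.
From mathcomp Require Import ring lra zify.
Import Order.TTheory GRing.Theory Num.Theory.
Import numFieldNormedType.Exports.
Set Implicit Arguments.
Unset Strict Implicit.
Unset Printing Implicit Defensive.
Local Open Scope ring_scope.

(** * Quadratic forms *)

(** Convertible with the expression inside [posdefmx] and [negsemidefmx], so that goals about these
    pass to [qf] by a mere change of form. *)
Definition qf (R : realType) (q : nat) (X : 'M[R]_q) (v : 'cV[R]_q) : R :=
  (v^T *m X *m v) 0 0.

Definition sqn (R : realType) (q : nat) (v : 'cV[R]_q) : R := (v^T *m v) 0 0.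

(** A submultiplicative norm on rectangular matrices that bounds every entry and, against [sqn],
    every quadratic form. All estimates below use it, so no spectral theory enters. *)
Definition l1 (R : realType) (p q : nat) (X : 'M[R]_(p, q)) : R :=
  \sum_i \sum_j `|X i j|.

Section QuadraticForms.
Context {R : realType}.

Lemma qfE q (X : 'M[R]_q) v : qf X v = \sum_i \sum_j v i 0 * X i j * v j 0.
Proof.
rewrite /qf mxE exchange_big; apply: eq_bigr => j _.
by rewrite mxE mulr_suml; apply: eq_bigr => i _; rewrite mxE.
Qed.

Lemma sqnE q (v : 'cV[R]_q) : sqn v = \sum_i v i 0 ^+ 2.
Proof. by rewrite /sqn mxE; apply: eq_bigr => i _; rewrite mxE expr2. Qed.

Lemma sqn_ge0 q (v : 'cV[R]_q) : 0 <= sqn v.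
Proof. by rewrite sqnE sumr_ge0 // => i _; rewrite sqr_ge0. Qed.

Lemma sqn_gt0 q (v : 'cV[R]_q) : v != 0 -> 0 < sqn v.
Proof.
move=> v0; rewrite lt_def sqn_ge0 andbT; apply: contra v0.
rewrite sqnE psumr_eq0; last by move=> i _; rewrite sqr_ge0.
move=> /allP v0; apply/eqP/matrixP => i j; rewrite (ord1 j) mxE.
by have := v0 i (mem_index_enum _); rewrite sqrf_eq0 => /eqP.
Qed.

Lemma qfD q (X Y : 'M[R]_q) v : qf (X + Y) v = qf X v + qf Y v.
Proof. by rewrite /qf mulmxDr mulmxDl mxE. Qed.

Lemma qfN q (X : 'M[R]_q) v : qf (- X) v = - qf X v.
Proof. by rewrite /qf mulmxN mulNmx mxE. Qed.

Lemma qfB q (X Y : 'M[R]_q) v : qf (X - Y) v = qf X v - qf Y v.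
Proof. by rewrite qfD qfN. Qed.

Lemma qfZ q a (X : 'M[R]_q) v : qf (a *: X) v = a * qf X v.
Proof. by rewrite /qf -scalemxAr -scalemxAl mxE. Qed.

Lemma qf_sum q (I : finType) (X : I -> 'M[R]_q) v :
  qf (\sum_i X i) v = \sum_i qf (X i) v.
Proof.
elim/big_ind2: _ => // [|? ? ? ? <- <-]; last by rewrite qfD.
by rewrite /qf mulmx0 mul0mx mxE.
Qed.

Lemma qf_scalar q (a : R) (v : 'cV[R]_q) : qf a%:M v = a * sqn v.
Proof. by rewrite -scalemx1 qfZ /qf mulmx1. Qed.

Lemma qf_congr p q (X : 'M[R]_p) (Y : 'M[R]_(p, q)) v :
  qf (Y^T *m X *m Y) v = qf X (Y *m v).
Proof. by rewrite /qf trmx_mul !mulmxA. Qed.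

Lemma qf_gram p q (Y : 'M[R]_(p, q)) v : qf (Y^T *m Y) v = sqn (Y *m v).
Proof. by rewrite /qf /sqn trmx_mul !mulmxA. Qed.

Lemma qf_tr q (X : 'M[R]_q) v : qf X^T v = qf X v.
Proof.
by rewrite !qfE exchange_big; do 2![apply: eq_bigr => ? _]; rewrite !mxE; ring.
Qed.

Lemma l1_ge0 p q (X : 'M[R]_(p, q)) : 0 <= l1 X.
Proof. by do 2![apply: sumr_ge0 => ? _]. Qed.

Lemma ler_coord_l1 p q (X : 'M[R]_(p, q)) i j : `|X i j| <= l1 X.
Proof.
rewrite /l1 (bigD1 i) //= (bigD1 j) //= -addrA lerDl addr_ge0 ?sumr_ge0 //.
by move=> k _; apply: sumr_ge0.
Qed.

Lemma l1D p q (X Y : 'M[R]_(p, q)) : l1 (X + Y) <= l1 X + l1 Y.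
Proof.
rewrite /l1 -big_split ler_sum //= => i _; rewrite -big_split ler_sum //= => j _.
by rewrite mxE ler_normD.
Qed.

Lemma l1N p q (X : 'M[R]_(p, q)) : l1 (- X) = l1 X.
Proof. by do 2![apply: eq_bigr => ? _]; rewrite mxE normrN. Qed.

Lemma l1B p q (X Y : 'M[R]_(p, q)) : l1 (X - Y) <= l1 X + l1 Y.
Proof. by rewrite -(l1N Y) l1D. Qed.

Lemma l1Z p q a (X : 'M[R]_(p, q)) : l1 (a *: X) = `|a| * l1 X.
Proof.
rewrite /l1 mulr_sumr; apply: eq_bigr => i _; rewrite mulr_sumr.
by apply: eq_bigr => j _; rewrite mxE normrM.
Qed.

Lemma l1_tr p q (X : 'M[R]_(p, q)) : l1 X^T = l1 X.
Proof.
by rewrite /l1 exchange_big; do 2![apply: eq_bigr => ? _]; rewrite mxE.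
Qed.

Lemma l1_0 p q : l1 (0 : 'M[R]_(p, q)) = 0.
Proof. by do 2![apply: big1 => ? _]; rewrite mxE normr0. Qed.

Lemma l1M p q r (X : 'M[R]_(p, q)) (Y : 'M[R]_(q, r)) :
  l1 (X *m Y) <= l1 X * l1 Y.
Proof.
rewrite /l1 mulr_suml ler_sum // => i _.
apply: (@le_trans _ _ (\sum_j \sum_k `|X i k| * `|Y k j|)).
  apply: ler_sum => j _; rewrite mxE (le_trans (ler_norm_sum _ _ _)) //.
  by apply: ler_sum => k _; rewrite normrM.
rewrite exchange_big mulr_suml ler_sum //= => k _.
rewrite -mulr_sumr ler_wpM2l // (bigD1 k) //= lerDl sumr_ge0 // => l _.
by apply: sumr_ge0.
Qed.

Lemma l1_sum p q (I : Type) (r : seq I) (X : I -> 'M[R]_(p, q)) :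
  l1 (\sum_(i <- r) X i) <= \sum_(i <- r) l1 (X i).
Proof.
elim/big_rec2: _ => [|i x Y _ le]; first by rewrite l1_0.
by rewrite (le_trans (l1D _ _)) // lerD2l.
Qed.

(** Each product [|v_i| |v_j|] is at most half the sum of the two squares, hence at most [sqn v]. *)
Lemma normr_qf q (X : 'M[R]_q) v : `|qf X v| <= l1 X * sqn v.
Proof.
have sq i : `|v i 0| ^+ 2 <= sqn v.
  rewrite real_normK ?num_real // sqnE (bigD1 i) //= lerDl.
  by apply: sumr_ge0 => ? _; rewrite sqr_ge0.
rewrite qfE /l1 mulr_suml (le_trans (ler_norm_sum _ _ _)) // ler_sum // => i _.
rewrite mulr_suml (le_trans (ler_norm_sum _ _ _)) // ler_sum // => j _.
rewrite !normrM mulrAC mulrC ler_wpM2l //.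
have := sq i; have := sq j; have := sqr_ge0 (`|v i 0| - `|v j 0|); nra.
Qed.

Lemma qf_le_l1 q (X : 'M[R]_q) v : qf X v <= l1 X * sqn v.
Proof. exact: le_trans (ler_norm _) (normr_qf _ _). Qed.

Lemma sqn_mulmx_le p q (X : 'M[R]_(p, q)) v :
  sqn (X *m v) <= l1 (X^T *m X) * sqn v.
Proof. by rewrite -qf_gram qf_le_l1. Qed.

Lemma qf_block p q (X : 'M[R]_p) (Y : 'M[R]_(q, p)) (Z : 'M[R]_q) v w :
  qf (block_mx X Y^T Y Z) (col_mx v w) =
  qf X v + 2%:R * (w^T *m Y *m v) 0 0 + qf Z w.
Proof.
have addE (M M' : 'M[R]_1) : (M + M') 0 0 = M 0 0 + M' 0 0 by rewrite mxE.
rewrite /qf tr_col_mx mul_row_block mul_row_col !mulmxDl !addE.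
have -> : v^T *m Y^T *m w = (w^T *m Y *m v)^T.
  by rewrite !trmx_mul !trmxK mulmxA.
rewrite [_^T 0 0]mxE; ring.
Qed.

Lemma posdefmx_qf q (X : 'M[R]_q) v : posdefmx X -> 0 <= qf X v.
Proof.
move=> [_ X_gt0]; have [->|/X_gt0/ltW//] := eqVneq v 0.
by rewrite /qf mulmx0 mxE.
Qed.

Lemma posdefmx_unit q (X : 'M[R]_q) : posdefmx X -> X \in unitmx.
Proof.
move=> [X_sym X_gt0]; rewrite -row_free_unit -kermx_eq0.
apply/negPn/negP => /rowV0Pn [v /sub_kermxP vX v0].
by have := X_gt0 v^T; rewrite trmx_eq0 trmxK vX mul0mx mxE ltxx => /(_ v0).
Qed.

Lemma tr_invmx q (X : 'M[R]_q) : X^T = X -> (invmx X)^T = invmx X.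
Proof. by move=> X_sym; rewrite trmx_inv X_sym. Qed.

Lemma posdefmx_inv q (X : 'M[R]_q) : posdefmx X -> posdefmx (invmx X).
Proof.
move=> X_pd; have X_unit := posdefmx_unit X_pd; have [X_sym X_gt0] := X_pd.
have Xi_sym := tr_invmx X_sym; split=> // v v0.
have -> : (v^T *m invmx X *m v) 0 0 = qf X (invmx X *m v).
  by rewrite -qf_congr Xi_sym mulVmx // mul1mx.
apply: X_gt0; apply: contra v0 => /eqP v0.
by rewrite -[v]mul1mx -(mulmxV X_unit) -mulmxA v0 mulmx0.
Qed.

(* Symmetric Gaussian elimination: the Schur complement of the corner entry is
   again positive definite. *)
Lemma cholesky q (X : 'M[R]_q) : posdefmx X -> exists L : 'M[R]_q, X = L^T *m L.
Proof.
elim: q X => [|q IHq] X; first by exists 0; apply/matrixP => [[]].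
(* [q.+1] is convertible with [1 + q], and the latter form allows [X] to be cut into blocks. *)
suff: forall X : 'M[R]_(1 + q), posdefmx X ->
    exists L : 'M[R]_(1 + q), X = L^T *m L by exact.
move=> {}X; have := submxK X.
move: (ulsubmx X) (ursubmx X) (dlsubmx X) (drsubmx X) => a c b C <-.
move=> [X_sym X_gt0]; move: X_sym.
rewrite tr_block_mx => /eq_block_mx [_ bc _ C_sym].
rewrite -bc in X_gt0 *.
have a_gt0 : 0 < a 0 0.
  have := X_gt0 (col_mx 1%:M 0); rewrite -[(_ *m _) 0 0]/(qf _ _) qf_block.
  rewrite col_mx_eq0 oner_eq0 /= => /(_ isT).
  by rewrite /qf !(mulmx0, trmx0, mul0mx) !trmx1 mul1mx mulmx1 !mxE mulr0 !addr0.
set r := Num.sqrt (a 0 0).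
have r_gt0 : 0 < r by rewrite sqrtr_gt0.
have r_sq : r * r = a 0 0 by rewrite -expr2 sqr_sqrtr // ltW.
have [|L L_eq] := IHq (C - (a 0 0)^-1 *: (b *m b^T)).
  split=> [|v v0].
    by rewrite raddfB /= linearZ /= trmx_mul trmxK C_sym.
  (* This first coordinate minimises the form for fixed [v], and the minimum is the value of the
     Schur complement at [v]. *)
  have := X_gt0 (col_mx (- ((a 0 0)^-1 *: (b^T *m v))) v).
  rewrite -[(_ *m _) 0 0]/(qf _ _) qf_block col_mx_eq0 (negPf v0) andbF.
  move=> /(_ isT).
  set w := b^T *m v; set s := w 0 0.
  have wE : w = s%:M by rewrite [LHS]mx11_scalar.
  have bw : (v^T *m b) = s%:M by rewrite -tr_scalar_mx -wE trmx_mul trmxK.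
  have qbb : qf (b *m b^T) v = s * s.
    by rewrite /qf mulmxA -mulmxA bw -/w wE -scalar_mxM mxE.
  have bl : (v^T *m b *m (- ((a 0 0)^-1 *: w))) 0 0 = - ((a 0 0)^-1 * (s * s)).
    by rewrite bw wE mulmxN -scalemxAr -scalar_mxM !mxE mulr1n.
  have qfa : qf a (- ((a 0 0)^-1 *: w)) = (a 0 0)^-1 * (s * s).
    rewrite wE [a in qf a _]mx11_scalar qf_scalar sqnE big_ord1 !mxE mulr1n.
    by field; rewrite gt_eqF.
  rewrite -[X in _ -> 0 < X]/(qf _ _) qfB qfZ qbb bl qfa.
  by move=> /lt_le_trans; apply; rewrite le_eqVlt; apply/orP; left;
     apply/eqP; ring.
exists (block_mx r%:M (r^-1 *: b^T) 0 L).
rewrite tr_block_mx mulmx_block !tr_scalar_mx trmx0 !(mul0mx, mulmx0) !addr0.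
have -> : (r^-1 *: b^T)^T = r^-1 *: b by rewrite linearZ /= trmxK.
rewrite -scalar_mxM r_sq -L_eq.
congr block_mx.
- by rewrite [LHS]mx11_scalar.
- by rewrite mul_scalar_mx scalerA divff ?scale1r // gt_eqF.
- by rewrite mul_mx_scalar scalerA divff ?scale1r // gt_eqF.
- rewrite -scalemxAl -scalemxAr scalerA -invfM r_sq addrC subrK //.
Qed.

(** With [X = L^T L], writing [v = L^-1 (L v)] bounds [sqn v] by a multiple of [sqn (L v) = qf X v].
    This replaces a compactness argument on the sphere. *)
Lemma posdefmx_ge q (X : 'M[R]_q) : posdefmx X ->
  exists2 c : R, 0 < c & forall v, c * sqn v <= qf X v.
Proof.
move=> X_pd; have [L XE] := cholesky X_pd.
have L_unit : L \in unitmx.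
  by have := posdefmx_unit X_pd; rewrite XE unitmx_mul => /andP[].
set b := l1 ((invmx L)^T *m invmx L).
have b_ge0 : 0 <= b by apply: l1_ge0.
have b1_gt0 : 0 < b + 1 by rewrite ltr_wpDl.
exists (b + 1)^-1; first by rewrite invr_gt0.
move=> v; rewrite XE qf_gram mulrC ler_pdivrMr // mulrC.
have := sqn_mulmx_le (invmx L) (L *m v); rewrite mulmxA mulVmx // mul1mx -/b.
by move=> /le_trans; apply; rewrite ler_wpM2r ?sqn_ge0 // lerDl.
Qed.

Lemma posdefmx_le q (X : 'M[R]_q) c : X^T = X -> 0 < c ->
  (forall v, c * sqn v <= qf X v) -> posdefmx X.
Proof.
move=> X_sym c_gt0 X_ge; split=> // v v0.
by apply: lt_le_trans (X_ge v); rewrite mulr_gt0 ?sqn_gt0.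
Qed.

End QuadraticForms.

(** * Polynomial matrices *)

Section PolynomialMatrices.
Context {R : realType}.

Lemma evalpmxM p q r (X : 'M[{poly R}]_(p, q)) (Y : 'M[{poly R}]_(q, r)) t :
  evalpmx (X *m Y) t = evalpmx X t *m evalpmx Y t.
Proof. exact: (map_mxM (horner_eval t)). Qed.

Lemma evalpmxD p q (X Y : 'M[{poly R}]_(p, q)) t :
  evalpmx (X + Y) t = evalpmx X t + evalpmx Y t.
Proof. exact: (map_mxD (horner_eval t)). Qed.

Lemma evalpmxN p q (X : 'M[{poly R}]_(p, q)) t :
  evalpmx (- X) t = - evalpmx X t.
Proof. exact: (map_mxN (horner_eval t)). Qed.

Lemma evalpmxB p q (X Y : 'M[{poly R}]_(p, q)) t :
  evalpmx (X - Y) t = evalpmx X t - evalpmx Y t.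
Proof. exact: (map_mxB (horner_eval t)). Qed.

Lemma evalpmxZ p q f (X : 'M[{poly R}]_(p, q)) t :
  evalpmx (f *: X) t = f.[t] *: evalpmx X t.
Proof. exact: (map_mxZ (horner_eval t)). Qed.

Lemma evalpmx_tr p q (X : 'M[{poly R}]_(p, q)) t :
  evalpmx X^T t = (evalpmx X t)^T.
Proof. by rewrite [RHS]map_trmx. Qed.

Lemma evalpmx_const p q (X : 'M[R]_(p, q)) t : evalpmx (constpmx X) t = X.
Proof. by apply/matrixP => i j; rewrite !mxE hornerC. Qed.

Definition evalpmxE :=
  (evalpmxM, evalpmxD, evalpmxN, evalpmxZ, evalpmx_tr, evalpmx_const).

Lemma evalpmx_block p q (X : 'M[{poly R}]_p) (Y : 'M[{poly R}]_(p, q))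
    (Z : 'M[{poly R}]_(q, p))    (W : 'M[{poly R}]_q) t :
  evalpmx (block_mx X Y Z W) t =
  block_mx (evalpmx X t) (evalpmx Y t) (evalpmx Z t) (evalpmx W t).
Proof. exact: map_block_mx. Qed.

Lemma constpmxM p q r (X : 'M[R]_(p, q)) (Y : 'M[R]_(q, r)) :
  constpmx (X *m Y) = constpmx X *m constpmx Y.
Proof. exact: map_mxM. Qed.

Lemma constpmxN p q (X : 'M[R]_(p, q)) : constpmx (- X) = - constpmx X.
Proof. exact: map_mxN. Qed.

Lemma constpmxZ p q a (X : 'M[R]_(p, q)) :
  constpmx (a *: X) = a%:P *: constpmx X.
Proof. exact: map_mxZ. Qed.

Lemma constpmx_sum p q (I : Type) (s : seq I) (X : I -> 'M[R]_(p, q)) :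
  constpmx (\sum_(i <- s) X i) = \sum_(i <- s) constpmx (X i).
Proof. by rewrite /constpmx raddf_sum. Qed.

Lemma constpmx_tr p q (X : 'M[R]_(p, q)) : constpmx X^T = (constpmx X)^T.
Proof. by rewrite [RHS]map_trmx. Qed.

Lemma derivpmxM p q r (X : 'M[{poly R}]_(p, q)) (Y : 'M[{poly R}]_(q, r)) :
  derivpmx (X *m Y) = derivpmx X *m Y + X *m derivpmx Y.
Proof.
apply/matrixP => i j; rewrite !mxE raddf_sum -big_split; apply: eq_bigr => k _.
by rewrite /= derivM !mxE.
Qed.

Lemma derivpmxD p q (X Y : 'M[{poly R}]_(p, q)) :
  derivpmx (X + Y) = derivpmx X + derivpmx Y.
Proof. by apply/matrixP => i j; rewrite !mxE derivD. Qed.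

Lemma derivpmxZ p q f (X : 'M[{poly R}]_(p, q)) :
  derivpmx (f *: X) = f^`() *: X + f *: derivpmx X.
Proof. by apply/matrixP => i j; rewrite !mxE derivM. Qed.

Lemma derivpmx_const p q (X : 'M[R]_(p, q)) : derivpmx (constpmx X) = 0.
Proof. by apply/matrixP => i j; rewrite !mxE derivC. Qed.

Lemma derivpmx_tr p q (X : 'M[{poly R}]_(p, q)) :
  derivpmx X^T = (derivpmx X)^T.
Proof. by apply/matrixP => i j; rewrite !mxE. Qed.

Lemma normr_horner_le (f : {poly R}) (b t : R) : `|t| <= b ->
  `|f.[t]| <= \sum_(i < size f) `|f`_i| * b ^+ i.
Proof.
move=> tb; rewrite horner_coef (le_trans (ler_norm_sum _ _ _)) //.
apply: ler_sum => i _; rewrite normrM ler_wpM2l // normrX.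
by rewrite lerXn2r // nnegrE // (le_trans _ tb).
Qed.

Lemma evalpmx_bounded p q (X : 'M[{poly R}]_(p, q)) b :
  exists2 c, 0 <= c & forall t, `|t| <= b -> l1 (evalpmx X t) <= c.
Proof.
have [b_lt0|b_ge0] := ltP b 0.
  by exists 0 => // t /(le_trans (normr_ge0 t)); rewrite leNgt b_lt0.
exists (\sum_i \sum_j \sum_(k < size (X i j)) `|(X i j)`_k| * b ^+ k).
  do 3![apply: sumr_ge0 => ? _]; by rewrite mulr_ge0 ?exprn_ge0.
move=> t tb; do 2![apply: ler_sum => ? _].
by rewrite mxE normr_horner_le.
Qed.

Lemma SOSmx_sym q (X : 'M[{poly R}]_q) : SOSmx X -> X^T = X.
Proof. by move=> [r [Y ->]]; rewrite trmx_mul trmxK. Qed.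

Lemma SOSmx_eval q (X : 'M[{poly R}]_q) t v :
  SOSmx X -> 0 <= qf (evalpmx X t) v.
Proof.
by move=> [r [Y ->]]; rewrite !evalpmxE qf_gram sqn_ge0.
Qed.

Lemma SOSmx0 q : SOSmx (0 : 'M[{poly R}]_q).
Proof. by exists 0, 0; rewrite mulmx0. Qed.

Lemma SOSmxD q (X Y : 'M[{poly R}]_q) : SOSmx X -> SOSmx Y -> SOSmx (X + Y).
Proof.
move=> [r [X' ->]] [s [Y' ->]]; exists (r + s)%N, (col_mx X' Y').
by rewrite tr_col_mx mul_row_col.
Qed.

Lemma SOSmx_congr p q (X : 'M[{poly R}]_p) (Y : 'M[{poly R}]_(p, q)) :
  SOSmx X -> SOSmx (Y^T *m X *m Y).
Proof.
by move=> [r [Z ->]]; exists r, (Z *m Y); rewrite trmx_mul !mulmxA.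
Qed.

Lemma SOSmx_scale_sqr q f (X : 'M[{poly R}]_q) :
  SOSmx X -> SOSmx ((f ^+ 2) *: X).
Proof.
move=> [r [Y ->]]; exists r, (f *: Y).
by rewrite [(f *: Y)^T]linearZ /= -scalemxAl -scalemxAr scalerA expr2.
Qed.

Lemma SOSmx_scale_ge0 q c (X : 'M[{poly R}]_q) :
  0 <= c -> SOSmx X -> SOSmx (c%:P *: X).
Proof.
by move=> /sqr_sqrtr <-; rewrite rmorphXn; exact: SOSmx_scale_sqr.
Qed.

Lemma SOSmx_const_posdef q (X : 'M[R]_q) : posdefmx X -> SOSmx (constpmx X).
Proof.
move=> /cholesky [L ->]; exists q, (constpmx L).
by rewrite constpmxM constpmx_tr.
Qed.

Lemma SOSmx_comp q f (X : 'M[{poly R}]_q) :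
  SOSmx X -> SOSmx (map_mx (comp_poly f) X).
Proof.
move=> [r [Y ->]]; exists r, (map_mx (comp_poly f) Y).
by rewrite map_mxM map_trmx.
Qed.

End PolynomialMatrices.

(** * Positive definite matrix polynomials on an interval *)

Section IntervalPositivstellensatz.
Context {R : realType}.

(** The quadratic module generated by [g] in the matrix polynomials. Membership certifies
    semidefiniteness wherever [g] is nonnegative. *)
Definition quadmod (q : nat) (g : {poly R}) (W : 'M[{poly R}]_q) : Prop :=
  exists S0 S1, [/\ SOSmx S0, SOSmx S1 & W = S0 + g *: S1].

Lemma quadmod_sum q g (I : Type) (s : seq I) (W : I -> 'M[{poly R}]_q) :
  (forall i, quadmod g (W i)) -> quadmod g (\sum_(i <- s) W i).
Proof.
move=> W_qm; elim/big_ind: _ => //.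
  by exists 0, 0; split; rewrite ?scaler0 ?addr0 //; exact: SOSmx0.
move=> X Y [S0 [S1 [S0_sos S1_sos ->]]] [T0 [T1 [T0_sos T1_sos ->]]].
exists (S0 + T0), (S1 + T1); split; try exact: SOSmxD.
by rewrite scalerDr addrACA.
Qed.

Lemma pmx_expansion q (W : 'M[{poly R}]_q) : exists p,
  W = \sum_(i < p) 'X^i *: constpmx (map_mx (coefp i) W).
Proof.
pose p := (\max_i \max_j size (W i j))%N.
exists p; apply/matrixP => i j.
rewrite summxE; apply/polyP => k; rewrite coef_sum.
rewrite (eq_bigr (fun l : 'I_p => (W i j)`_l * (k == l)%:R)); last first.
  by move=> l _; rewrite !mxE mulrC coefCM coefXn.
case: (ltnP k p) => [k_lt|k_ge].
  rewrite (bigD1 (Ordinal k_lt)) //= eqxx mulr1 big1 ?addr0 // => l.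
  by rewrite -val_eqE eq_sym /= => /negPf ->; rewrite mulr0.
rewrite nth_default.
  rewrite big1 // => l _; rewrite gtn_eqF ?mulr0 //.
  exact: leq_trans (ltn_ord l) _.
apply: leq_trans k_ge.
by apply: leq_trans (leq_bigmax i); exact: (leq_bigmax j).
Qed.

(** Multiplied by [(k - i)! (d - k)!], both sides become [d!]. *)
Lemma bin_ffactE d k i : (i <= k <= d)%N ->
  ('C(d, k) * k ^_ i = d ^_ i * 'C(d - i, k - i))%N.
Proof.
move=> /andP[ik kd].
have f_gt0 : (0 < (k - i)`! * (d - k)`!)%N by rewrite muln_gt0 !fact_gt0.
apply/eqP; rewrite -(eqn_pmul2r f_gt0); apply/eqP.
transitivity d`!.
  by rewrite -(bin_fact kd) -(ffact_fact ik) !mulnA.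
have id : (i <= d)%N := leq_trans ik kd.
rewrite -(ffact_fact id) -(bin_fact (leq_sub2r i kd)) subnBA // subnK //.
by rewrite mulnA.
Qed.

(** Expand ['X^i * ('X + (1 - 'X)) ^+ (d - i)] by the binomial theorem and rewrite the binomials
    with [bin_ffactE]. The terms with [k < i] have a vanishing falling factorial. *)
Lemma monomial_bernstein d i : (i <= d)%N ->
  'X^i = \sum_(k < d.+1) ('C(d, k)%:R * (k ^_ i)%:R / (d ^_ i)%:R : R)
                         *: ('X^k * (1 - 'X) ^+ (d - k)).
Proof.
move=> id; have dn0 : (d ^_ i)%:R != 0 :> R.
  by rewrite pnatr_eq0 -lt0n ffact_gt0.
rewrite -(big_mkord xpredT (fun k => ('C(d, k)%:R * (k ^_ i)%:R / (d ^_ i)%:R)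
   *: ('X^k * (1 - 'X) ^+ (d - k)))) (@big_cat_nat _ _ _ i) //=; last exact: leqW.
rewrite big1_seq ?add0r; last first.
  move=> k /andP[_]; rewrite mem_index_iota => /andP[_ ki].
  by rewrite ffact_small // mulr0 mul0r scale0r.
rewrite -{2}[i]add0n big_addn big_mkord subSn //.
rewrite -[LHS]mulr1 -[1 in LHS](expr1n _ (d - i)) -{1}[1](subrK 'X).
rewrite exprDn mulr_sumr; apply: eq_bigr => -[k /= kd] _.
rewrite -natrM bin_ffactE; last by rewrite leq_addl -[d](subnK id) leq_add2r.
rewrite natrM mulrAC divff // mul1r addnK -subnDA [(i + k)%N]addnC.
by rewrite scaler_nat mulrnAr exprD; congr (_ *+ _); ring.
Qed.

Lemma ffact_ratio_bounds d k i : (k <= d)%N -> (i <= d)%N ->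
  0 <= ((k ^_ i)%:R / (d ^_ i)%:R : R) <= 1.
Proof.
move=> kd id; rewrite divr_ge0 //= ler_pdivrMr ?mul1r ?ltr0n ?ffact_gt0 //.
rewrite ler_nat; elim: i id => [|i IHi] id; first by rewrite !ffactn0.
by rewrite !ffactnSr leq_mul // ?leq_sub2r // IHi // ltnW.
Qed.

(** Induction on [i]: the new factor [(k - i) / (d - i)] differs from [k / d] by at most [i / d],
    all quantities lie in [0, 1], and [i * i + i] is at most [(i + 1) * (i + 1)]. *)
Lemma ffact_ratio_approx d k i : (k <= d)%N -> (i < d)%N ->
  `|(k ^_ i)%:R / (d ^_ i)%:R - (k%:R / d%:R) ^+ i| <= (i * i)%:R / d%:R :> R.
Proof.
move=> kd; elim: i => [|i IHi] id.
  by rewrite !ffactn0 expr0 divr1 subrr normr0 mul0r.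
have {}IHi := IHi (ltnW id); have id' := ltnW id.
have d_gt0 : (0 : R) < d%:R by rewrite ltr0n (leq_trans _ id).
have di_gt0 : (0 : R) < (d - i)%:R by rewrite ltr0n subn_gt0.
set u := _ / _ in IHi *; set y : R := k%:R / d%:R in IHi *.
have /andP[u_ge0 u_le1] : 0 <= u <= 1.
  by apply: ffact_ratio_bounds => //; exact: ltnW.
have y_ge0 : 0 <= y by rewrite divr_ge0.
have y_le1 : y <= 1 by rewrite ler_pdivrMr // mul1r ler_nat.
set x : R := (k - i)%:R / (d - i)%:R.
have x_ge0 : 0 <= x by rewrite divr_ge0.
have x_le1 : x <= 1 by rewrite ler_pdivrMr // mul1r ler_nat leq_sub2r.
have xy : `|x - y| <= i%:R / d%:R.
  (* For [k <= i] the truncated subtraction makes [x] zero, and [y = k / d] is itself at most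
     [i / d]. *)
  rewrite /x /y; case: (leqP k i) => [ki|/ltnW ik].
    have /eqP -> : (k - i == 0)%N by rewrite subn_eq0.
    by rewrite mul0r sub0r normrN ger0_norm // ler_wpM2r ?invr_ge0 ?ler0n ?ler_nat.
  rewrite !natrB ?(ltnW id') // in di_gt0 *.
  have kd' : k%:R <= d%:R :> R by rewrite ler_nat.
  have ik' : i%:R <= k%:R :> R by rewrite ler_nat.
  have i_ge0 : 0 <= i%:R :> R by [].
  rewrite ler_norml; apply/andP; split.
    rewrite lerBrDl -mulrBl ler_wpM2l ?subr_ge0 // lef_pV2 ?posrE //.
    by rewrite lerBlDr lerDl.
  rewrite (@le_trans _ _ 0) ?divr_ge0 // subr_le0.
  by rewrite ler_pdivrMr // mulrAC ler_pdivlMr //; nra.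
have -> : (k ^_ i.+1)%:R / (d ^_ i.+1)%:R = u * x :> R.
  by rewrite !ffactnSr !natrM invfM /u /x; ring.
clearbody u x y; rewrite exprSr.
rewrite (_ : _ - _ = (u - y ^+ i) * x + y ^+ i * (x - y)); last by ring.
rewrite (le_trans (ler_normD _ _)) // !normrM.
apply: (@le_trans _ _ ((i * i)%:R / d%:R + i%:R / d%:R)).
  apply: lerD.
    by rewrite -[leRHS]mulr1; apply: ler_pM => //; rewrite ger0_norm.
  rewrite -[leRHS]mul1r; apply: ler_pM => //.
  by rewrite ger0_norm ?exprn_ge0 // exprn_ile1.
rewrite -mulrDl ler_wpM2r ?invr_ge0 ?ler0n // -natrD ler_nat; lia.
Qed.

(** The sum in the conclusion is the [k]-th Bernstein coefficient in degree [d], up to the binomial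
    factor. By [ffact_ratio_approx] it differs from the value at [k / d] by at most [c'], which is
    below [c] once [d] is large. *)
Lemma bernstein_posdef q p (C : 'I_p -> 'M[R]_q) (c : R) d :
  (forall i, (C i)^T = C i) -> 0 < c -> (p <= d)%N ->
  (p * p)%:R * (\sum_i l1 (C i)) < d%:R * c ->
  (forall t : R, 0 <= t <= 1 -> forall v,
    c * sqn v <= qf (\sum_(i < p) t ^+ i *: C i) v) ->
  forall k, (k <= d)%N ->
  posdefmx (\sum_(i < p) ((k ^_ i)%:R / (d ^_ i)%:R) *: C i).
Proof.
move=> C_sym c_gt0 pd d_large C_ge k kd.
have [d0|d_gt0] := posnP d.
  move: d_large; rewrite d0 mul0r ltNge mulr_ge0 //.
  by apply: sumr_ge0 => i _; exact: l1_ge0.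
have dR_gt0 : 0 < d%:R :> R by rewrite ltr0n.
pose c' : R := (p * p)%:R / d%:R * \sum_i l1 (C i).
have c'_lt : 0 < c - c'.
  by rewrite subr_gt0 /c' mulrAC ltr_pdivrMr // [c * _]mulrC.
apply: (@posdefmx_le _ _ _ (c - c')) => // [|v].
  rewrite raddf_sum; apply: eq_bigr => i _.
  by rewrite /= [LHS]linearZ /= C_sym.
have kd1 : 0 <= (k%:R / d%:R : R) <= 1.
  by rewrite divr_ge0 //= ler_pdivrMr // mul1r ler_nat.
rewrite mulrBl lerBlDr (le_trans (C_ge _ kd1 v)) // -lerBlDl -qfB -sumrB.
under eq_bigr => i _ do rewrite -scalerBl.
rewrite qf_sum /c' mulr_sumr mulr_suml ler_sum // => i _.
rewrite qfZ (le_trans (ler_norm _)) // normrM -[leRHS]mulrA.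
apply: ler_pM => //; last exact: normr_qf.
rewrite distrC.
apply: (le_trans (ffact_ratio_approx kd (leq_trans (ltn_ord i) pd))).
by rewrite ler_wpM2r ?invr_ge0 ?ler0n // ler_nat leq_mul // ltnW.
Qed.

(** In even degree the exponents [k] and [2e - k] have the same parity: the Bernstein polynomial is
    a square if both are even, and ['X * (1 - 'X)] times a square if both are odd. *)
Lemma bernstein_quadmod q e k (C : 'M[R]_q) : (k <= e.*2)%N -> posdefmx C ->
  quadmod ('X * (1 - 'X)) (('X^k * (1 - 'X) ^+ (e.*2 - k)) *: constpmx C).
Proof.
move=> ke /SOSmx_const_posdef C_sos.
case: (boolP (odd k)) => k_odd.
  have kE : k = k./2.*2.+1 by rewrite -[LHS]odd_double_half k_odd.
  have ke' : (k./2 < e)%N by lia.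
  exists 0, (('X^(k./2) * (1 - 'X) ^+ (e - k./2.+1)) ^+ 2 *: constpmx C).
  split; [exact: SOSmx0 | exact: SOSmx_scale_sqr |].
  rewrite add0r scalerA; congr (_ *: _).
  have -> : (e.*2 - k = (e - k./2.+1).*2.+1)%N by lia.
  rewrite {1}kE -!muln2 !exprS !exprM; ring.
have kE : k = k./2.*2 by rewrite -[LHS]odd_double_half (negPf k_odd).
exists (('X^(k./2) * (1 - 'X) ^+ (e - k./2)) ^+ 2 *: constpmx C), 0.
split; [exact: SOSmx_scale_sqr | exact: SOSmx0 |].
rewrite scaler0 addr0; congr (_ *: _).
have -> : (e.*2 - k = (e - k./2).*2)%N by lia.
by rewrite {1}kE -!muln2 !exprM exprMn.
Qed.

Lemma posdef_quadmod01 q (W : 'M[{poly R}]_q) c : W^T = W -> 0 < c ->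
  (forall t : R, 0 <= t <= 1 -> forall v, c * sqn v <= qf (evalpmx W t) v) ->
  quadmod ('X * (1 - 'X)) W.
Proof.
move=> W_sym c_gt0 W_ge; have [p WE] := pmx_expansion W.
pose C (i : 'I_p) := map_mx (coefp i) W.
have C_sym i : (C i)^T = C i by rewrite map_trmx W_sym.
have WtE t : evalpmx W t = \sum_(i < p) t ^+ i *: C i.
  apply/matrixP => i j; rewrite WE !mxE !summxE horner_sum.
  by apply: eq_bigr => l _; rewrite !mxE !hornerE.
have B_ge0 : 0 <= \sum_i l1 (C i) by apply: sumr_ge0 => i _; exact: l1_ge0.
(* The Bernstein degree [2e] must be at least [p] and satisfy the largeness condition of
   [bernstein_posdef]; the Archimedean bound provides the latter. *)
pose e := (p + Num.bound ((p * p)%:R * (\sum_i l1 (C i)) / c))%N.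
have e_large : (p * p)%:R * (\sum_i l1 (C i)) < e.*2%:R * c.
  rewrite -ltr_pdivrMr // (lt_le_trans (archi_boundP _)) //.
    by rewrite divr_ge0 ?mulr_ge0 // ltW.
  by rewrite ler_nat -addnn (leq_trans (leq_addl p _)) // leq_addr.
have pe : (p <= e.*2)%N.
  by rewrite -addnn; exact: leq_trans (leq_addr _ _) (leq_addr _ _).
have CB_pd := bernstein_posdef C_sym c_gt0 pe e_large.
(* [W_ge] is transported along [WtE], since [bernstein_posdef] speaks of the expanded sum. *)
have {}CB_pd k : (k <= e.*2)%N -> posdefmx _ := CB_pd (fun t t01 v =>
  eq_ind _ (fun X => c * sqn v <= qf X v) (W_ge t t01 v) _ (WtE t)) k.
have -> : W = \sum_(k < e.*2.+1) ('X^k * (1 - 'X) ^+ (e.*2 - k)) *: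
    constpmx ('C(e.*2, k)%:R *:
      \sum_(i < p) ((k ^_ i)%:R / (e.*2 ^_ i)%:R) *: C i).
  rewrite {1}WE; under eq_bigr => i _.
    rewrite (monomial_bernstein (leq_trans (ltnW (ltn_ord i)) pe)) scaler_suml.
    over.
  rewrite exchange_big; apply: eq_bigr => k _.
  rewrite constpmxZ constpmx_sum scaler_sumr scaler_sumr.
  apply: eq_bigr => i _; rewrite constpmxZ !scalerA; congr (_ *: _).
  by rewrite -mul_polyC !polyCM; ring.
apply: quadmod_sum => -[k /= ke]; apply: bernstein_quadmod => //.
have [Y_sym Y_gt0] := CB_pd k ke; split=> [|v v0].
  by rewrite linearZ /= Y_sym.
rewrite -[X in 0 < X]/(qf _ _) qfZ mulr_gt0 //; first by rewrite ltr0n bin_gt0.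
exact: Y_gt0.
Qed.

(** Reduction to [0, 1] by the affine map [f] with inverse [f']. Composing ['X * (1 - 'X)] with [f']
    yields the multiplier over [(b - a) ^+ 2], and this positive constant is absorbed into [S1]. *)
Lemma posdef_quadmod_lt q (W : 'M[{poly R}]_q) (a b c : R) :
  a < b -> W^T = W -> 0 < c ->
  (forall t, a <= t <= b -> forall v, c * sqn v <= qf (evalpmx W t) v) ->
  quadmod (('X - a%:P) * (b%:P - 'X)) W.
Proof.
move=> ab W_sym c_gt0 W_ge; have ba_gt0 : 0 < b - a by rewrite subr_gt0.
pose f : {poly R} := a%:P + (b - a)%:P * 'X.
pose f' : {poly R} := (b - a)^-1%:P * ('X - a%:P).
have ff' : f \Po f' = 'X.
  rewrite /f /f' !(comp_polyD, comp_polyM, comp_polyC, comp_polyX).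
  by rewrite mulrA -polyCM divff ?gt_eqF // mul1r addrC subrK.
have [||S0 [S1 [S0_sos S1_sos WE]]] :=
    @posdef_quadmod01 q (map_mx (comp_poly f) W) c _ c_gt0.
- by rewrite map_trmx W_sym.
- move=> t /andP[t_ge0 t_le1] v.
  have -> : evalpmx (map_mx (comp_poly f) W) t = evalpmx W (a + (b - a) * t).
    by apply/matrixP => i j; rewrite !mxE horner_comp !hornerE.
  by apply: W_ge; apply/andP; split; nra.
exists (map_mx (comp_poly f') S0),
  (((b - a)^-1 ^+ 2)%:P *: map_mx (comp_poly f') S1); split.
- exact: SOSmx_comp.
- by apply: SOSmx_scale_ge0; [rewrite exprn_ge0 // invr_ge0 ltW|exact: SOSmx_comp].
have -> : W = map_mx (comp_poly f') (map_mx (comp_poly f) W).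
  by apply/matrixP => i j; rewrite !mxE -comp_polyA ff' comp_polyXr.
rewrite WE map_mxD map_mxZ scalerA; congr (_ + _ *: _).
rewrite /= comp_polyM comp_polyB comp_polyC comp_polyX.
rewrite (_ : 1%:P - f' = (b - a)^-1%:P * (b%:P - 'X)).
  by rewrite /f' expr2 polyCM; ring.
have : (b - a)^-1%:P * (b - a)%:P = 1 :> {poly R}.
  by rewrite -polyCM mulVf // gt_eqF.
rewrite polyCB /f' polyC1 => <-; ring.
Qed.

(* For [a = b] the polynomial is positive definite on a slightly larger interval
   [[a - eta, a + eta]], and [eta ^+ 2 - ('X - a) ^+ 2] differs from
   [- ('X - a) ^+ 2] by a nonnegative constant. *)
Lemma posdef_quadmod q (W : 'M[{poly R}]_q) (a b c : R) :
  a <= b -> W^T = W -> 0 < c ->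
  (forall t, a <= t <= b -> forall v, c * sqn v <= qf (evalpmx W t) v) ->
  quadmod (('X - a%:P) * (b%:P - 'X)) W.
Proof.
rewrite le_eqVlt => /predU1P[<-{b}|]; last exact: posdef_quadmod_lt.
move=> W_sym c_gt0 W_ge.
(* The divided difference of [W] at [a], which controls how much [W] can vary near [a]. *)
pose V : 'M[{poly R}]_q :=
  map_mx (fun f : {poly R} => (f - f.[a]%:P) %/ ('X - a%:P)) W.
have WV t : evalpmx W t = evalpmx W a + (t - a) *: evalpmx V t.
  apply/matrixP => i j; rewrite !mxE; set f := W i j.
  have : 'X - a%:P %| f - f.[a]%:P by rewrite dvdp_XsubCl rootE !hornerE subrr.
  move=> /divpK /(congr1 (horner^~ t)); rewrite !hornerE => fE.
  by rewrite mulrC fE addrC subrK.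
have [B B_ge0 V_le] := evalpmx_bounded V (`|a| + 1).
have B1_gt0 : 0 < B + 1 by rewrite ltr_wpDl.
(* Within distance [eta] of [a] the form of [W] changes by at most [c / 2], so half of the lower
   bound survives. The cap 1 keeps the points in the range where [V] is bounded by [B]. *)
pose eta : R := Num.min 1 (c / 2 / (B + 1)).
have eta_gt0 : 0 < eta by rewrite lt_min ltr01 !divr_gt0.
have eta_le1 : eta <= 1 by rewrite ge_min lexx.
have eta_le : eta * (B + 1) <= c / 2.
  by rewrite -ler_pdivlMr // ge_min lexx orbT.
have ab : a - eta < a + eta by rewrite ltrD2l gt0_cp.
have c2_gt0 : 0 < c / 2 by rewrite divr_gt0.
have [t /andP[t_ge t_le] v|S0 [S1 [S0_sos S1_sos WE]]] :=
  @posdef_quadmod_lt q W _ _ (c / 2) ab W_sym c2_gt0.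
  have ta : `|t - a| <= eta by rewrite ler_norml; apply/andP; split; lra.
  have t_bd : `|t| <= `|a| + 1.
    rewrite -(subrK a t) addrC (le_trans (ler_normD _ _)) // lerD2l.
    exact: le_trans ta _.
  have := W_ge a; rewrite lexx => /(_ isT v); rewrite (WV t) qfD qfZ.
  have : `|(t - a) * qf (evalpmx V t) v| <= c / 2 * sqn v.
    rewrite normrM (@le_trans _ _ (eta * (B * sqn v))) //.
      rewrite ler_pM // (le_trans (normr_qf _ _)) //.
      by rewrite ler_wpM2r ?sqn_ge0 // V_le.
    rewrite mulrA ler_wpM2r ?sqn_ge0 //; nra.
  by rewrite ler_norml => /andP[lo _] ge_a; lra.
exists (S0 + (eta ^+ 2)%:P *: S1), S1; split=> //.
  by apply: SOSmxD => //; apply: SOSmx_scale_ge0; rewrite ?sqr_ge0.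
rewrite WE -addrA -scalerDl; congr (_ + _ *: _).
rewrite !(polyCD, polyCN) rmorphXn /=; ring.
Qed.

End IntervalPositivstellensatz.

(** * Matrix exponential *)

Section MatrixExponential.
Local Open Scope classical_set_scope.
Local Open Scope ring_scope.
Context {R : realType}.

Definition pexpmx_term (q : nat) (A : 'M[R]_q) (k : nat) : 'M[{poly R}]_q :=
  ((k`!%:R)^-1 *: 'X^k) *: constpmx (A ^+ k).

(** The index counts terms: the section of index 0 is zero, and differentiating the section of index
    [k.+1] gives [A] times the one of index [k]. The last term [pexpmx_term A k] is therefore the
    defect in the differential equation. *)
Definition pexpmx (q : nat) (A : 'M[R]_q) (k : nat) : 'M[{poly R}]_q :=
  \sum_(i < k) pexpmx_term A i.

Lemma pexpmxS q (A : 'M[R]_q) k :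
  pexpmx A k.+1 = pexpmx A k + pexpmx_term A k.
Proof. by rewrite /pexpmx big_ord_recr. Qed.

Lemma exprmxZ q a (A : 'M[R]_q) k : (a *: A) ^+ k = a ^+ k *: A ^+ k.
Proof.
elim: k => [|k IHk]; first by rewrite !expr0 scale1r.
by rewrite !exprS IHk -[LHS]scalemxAl -scalemxAr scalerA.
Qed.

Lemma evalpmx_pexp_term q (A : 'M[R]_q) k t :
  evalpmx (pexpmx_term A k) t = (k`!%:R)^-1 *: (t *: A) ^+ k.
Proof. by rewrite evalpmxZ evalpmx_const !hornerE exprmxZ scalerA. Qed.

Lemma evalpmx_sum p q (I : Type) (s : seq I) (X : I -> 'M[{poly R}]_(p, q)) t :
  evalpmx (\sum_(i <- s) X i) t = \sum_(i <- s) evalpmx (X i) t.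
Proof. by rewrite /evalpmx (raddf_sum (map_mx (horner_eval t))). Qed.

Lemma evalpmx_pexp q (A : 'M[R]_q) k t : evalpmx (pexpmx A k) t =
  series (fun i => (i`!%:R)^-1 *: (t *: A) ^+ i) k.
Proof.
rewrite /pexpmx evalpmx_sum seriesEord; apply: eq_bigr => i _.
exact: evalpmx_pexp_term.
Qed.

Lemma evalpmx_pexpN q (A : 'M[R]_q) k t :
  evalpmx (pexpmx (- A) k) t = evalpmx (pexpmx A k) (- t).
Proof. by rewrite !evalpmx_pexp scalerN scaleNr. Qed.

Lemma evalpmx_pexp0 q (A : 'M[R]_q) k : evalpmx (pexpmx A k.+1) 0 = 1%:M.
Proof.
rewrite /pexpmx evalpmx_sum big_ord_recl big1 ?addr0.
  by rewrite evalpmx_pexp_term expr0 invr1 scale1r.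
move=> i _; rewrite evalpmx_pexp_term scale0r expr0n /= scaler0 //.
Qed.

Lemma derivpmx_pexp q (A : 'M[R]_q) k :
  derivpmx (pexpmx A k.+1) = constpmx A *m pexpmx A k.
Proof.
have deriv_term0 : derivpmx (pexpmx_term A 0) = 0.
  rewrite /pexpmx_term derivpmxZ derivpmx_const derivZ derivC.
  by rewrite scaler0 scale0r scaler0 addr0.
have deriv_termS i : derivpmx (pexpmx_term A i.+1) = constpmx A *m pexpmx_term A i.
  rewrite /pexpmx_term derivpmxZ derivpmx_const scaler0 addr0.
  rewrite -scalemxAr -constpmxM -[A *m _]exprS; congr (_ *: _).
  have -> : (((i.+1)`!%:R^-1 : R) *: 'X^(i.+1))^`() =
      ((i.+1)`!%:R^-1 : R) *: (i.+1%:R *: 'X^i).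
    by rewrite derivZ derivXn scaler_nat.
  rewrite scalerA factS natrM invfM.
  by rewrite mulrAC mulVf ?mul1r // pnatr_eq0.
elim: k => [|k IHk]; rewrite pexpmxS derivpmxD ?deriv_termS.
  rewrite deriv_term0 /pexpmx !big_ord0 mulmx0 addr0.
  by rewrite -(scale0r 0) derivpmxZ derivC !scale0r addr0.
by rewrite IHk -mulmxDr -pexpmxS.
Qed.

Lemma comm_pexp q (A : 'M[R]_q) k :
  constpmx A *m pexpmx A k = pexpmx A k *m constpmx A.
Proof.
rewrite /pexpmx mulmx_sumr mulmx_suml; apply: eq_bigr => i _.
by rewrite -scalemxAl -scalemxAr -!constpmxM -[A *m _]exprS -[_ *m A]exprSr.
Qed.

Lemma pexp_tr q (A : 'M[R]_q) k : pexpmx A^T k = (pexpmx A k)^T.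
Proof.
rewrite /pexpmx [RHS]raddf_sum; apply: eq_bigr => i _ /=.
rewrite [RHS]linearZ /= -constpmx_tr; congr (_ *: constpmx _).
elim: (nat_of_ord i) => [|j IHj]; first by rewrite !expr0 trmx1.
by rewrite exprS exprSr trmx_mul IHj.
Qed.

Lemma l1_scalar1 q : l1 (1%:M : 'M[R]_q) = q%:R.
Proof.
rewrite /l1 (eq_bigr (fun=> 1)) ?sumr_const ?card_ord // => i _.
rewrite (bigD1 i) //= mxE eqxx normr1 big1 ?addr0 // => j ji.
by rewrite mxE eq_sym (negPf ji) normr0.
Qed.

(** The factor [q] is the norm of the identity, needed for the power 0. The scalar exponential
    series at [l1 A * T] thus dominates all terms uniformly in [t]. *)
Lemma l1_expmx_term q (A : 'M[R]_q) k t T : `|t| <= T ->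
  l1 ((k`!%:R)^-1 *: (t *: A) ^+ k) <= q%:R * exp_coeff (l1 A * T) k.
Proof.
move=> tT; have T_ge0 : 0 <= T := le_trans (normr_ge0 _) tT.
have l1X : l1 (A ^+ k) <= q%:R * l1 A ^+ k.
  elim: k => [|k IHk]; first by rewrite !expr0 l1_scalar1 mulr1.
  rewrite exprS (le_trans (l1M _ _)) // exprS mulrCA ler_wpM2l ?l1_ge0 //.
rewrite exprmxZ !l1Z /exp_coeff normfV ger0_norm //= normrX exprMn.
rewrite mulrC [leRHS]mulrA ler_wpM2r ?invr_ge0 // mulrA mulrC.
by rewrite ler_pM ?l1_ge0 ?exprn_ge0 // lerXn2r ?nnegrE.
Qed.

Lemma l1_series_sub q (A : 'M[R]_q) k l t T : `|t| <= T -> (k <= l)%N ->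
  l1 (evalpmx (pexpmx A l) t - evalpmx (pexpmx A k) t) <=
  q%:R * (expR (l1 A * T) - series (exp_coeff (l1 A * T)) k).
Proof.
move=> tT kl; have T_ge0 : 0 <= T := le_trans (normr_ge0 _) tT.
rewrite !evalpmx_pexp sub_series_geq // (le_trans (l1_sum _ _)) //.
apply: (@le_trans _ _ (\sum_(k <= i < l) q%:R * exp_coeff (l1 A * T) i)).
  by apply: ler_sum => i _; exact: l1_expmx_term.
rewrite -mulr_sumr ler_wpM2l // -sub_series_geq // lerB //.
apply: nondecreasing_cvgn_le; last exact: is_cvg_series_exp_coeff.
apply: nondecreasing_series => i _ _.
by rewrite exp_coeff_ge0 // mulr_ge0 ?l1_ge0.
Qed.

(** Each entry converges absolutely by comparison with the scalar series, and the tail bound of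
    [l1_series_sub] passes to the limit. *)
Lemma expmx_sub_le q (A : 'M[R]_q) k t T i j : `|t| <= T ->
  cvgn (fun l => (series (fun i => (i`!%:R)^-1 *: (t *: A) ^+ i) l) i j) /\
  `|limn (fun l => (series (fun i => (i`!%:R)^-1 *: (t *: A) ^+ i) l) i j)
    - evalpmx (pexpmx A k) t i j| <=
  q%:R * (expR (l1 A * T) - series (exp_coeff (l1 A * T)) k).
Proof.
move=> tT; set u := fun l => _.
have u_cvg : cvgn u.
  rewrite (_ : u = series (fun l => ((l`!%:R)^-1 *: (t *: A) ^+ l) i j)).
    apply: normed_cvg.
    apply: (@series_le_cvg _ _ (fun l => q%:R * exp_coeff (l1 A * T) l)).
    - by move=> l; exact: normr_ge0.
    - move=> l; rewrite mulr_ge0 // exp_coeff_ge0 // mulr_ge0 ?l1_ge0 //.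
      exact: le_trans (normr_ge0 _) tT.
    - move=> l; exact: le_trans (ler_coord_l1 _ _ _) (l1_expmx_term _ _ tT).
    - by apply: is_cvg_seriesZ; exact: is_cvg_series_exp_coeff.
  by apply/funext => l; rewrite /u /series /= summxE.
split=> //; rewrite ler_norml; set r := _ * _; set y := evalpmx _ _ _ _.
have ul l : (k <= l)%N -> `|u l - y| <= r.
  move=> kl; have := l1_series_sub A tT kl; rewrite -/r; apply: le_trans.
  rewrite evalpmx_pexp; apply: le_trans (ler_coord_l1 _ i j).
  by have -> (M N : 'M[R]_q) : (M - N) i j = M i j - N i j by rewrite !mxE.
rewrite lerBrDr lerBlDr; apply/andP; split.
  apply: limr_ge => //; near=> l.
  have /ul : (k <= l)%N by near: l; exact: nbhs_infty_ge.
  by rewrite ler_norml lerBrDr => /andP[].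
apply: limr_le => //; near=> l.
have /ul : (k <= l)%N by near: l; exact: nbhs_infty_ge.
by rewrite ler_norml lerBlDr => /andP[].
Unshelve. all: by end_near. Qed.

(** The tail bound is the same for all entries, so the matrix of entrywise limits is also the limit
    in norm, and limits are unique in a Hausdorff space. *)
Lemma expmxE q (A : 'M[R]_q) t i j :
  expmx (t *: A) i j =
  limn (fun l => (series (fun i => (i`!%:R)^-1 *: (t *: A) ^+ i) l) i j).
Proof.
pose u l := series (fun i => (i`!%:R)^-1 *: (t *: A) ^+ i) l.
pose tail l : R := q%:R * (expR (l1 A * `|t|) - series (exp_coeff (l1 A * `|t|)) l).
pose L := \matrix_(i, j) limn (fun l => u l i j).
have tail0 : tail @ \oo --> 0.
  rewrite -[X in _ --> X](mulr0 q%:R); apply: cvgMr.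
  rewrite -[X in _ --> X](subrr (expR (l1 A * `|t|))); apply: cvgB.
    exact: cvg_cst.
  exact: is_cvg_series_exp_coeff.
suff -> : expmx (t *: A) = L by rewrite mxE.
apply: cvg_lim; first exact: norm_hausdorff.
apply/cvgrPdist_le => e e_gt0.
have /cvgrPdist_le /(_ _ e_gt0) := tail0; apply: filterS => l /=.
rewrite sub0r normrN => tail_le.
rewrite /Num.norm /= mx_normrE; apply: bigmax_le; first exact: ltW.
move=> [i' j'] _; apply: le_trans (le_trans (ler_norm _) tail_le).
have [_] := expmx_sub_le A l i' j' (lexx `|t|).
by rewrite evalpmx_pexp 3!mxE.
Qed.

Lemma expmx_tr q (A : 'M[R]_q) t : expmx (t *: A^T) = (expmx (t *: A))^T.
Proof.
apply/matrixP => i j; rewrite mxE !expmxE; congr (limn _); apply/funext => k.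
by rewrite -!evalpmx_pexp pexp_tr evalpmx_tr mxE.
Qed.

Lemma l1_expmx_sub q (A : 'M[R]_q) k t T : `|t| <= T ->
  l1 (expmx (t *: A) - evalpmx (pexpmx A k) t) <=
  (q * q)%:R * (q%:R * (expR (l1 A * T) - series (exp_coeff (l1 A * T)) k)).
Proof.
move=> tT; set tail := q%:R * _.
have L_sub i j : `|(expmx (t *: A) - evalpmx (pexpmx A k) t) i j| <= tail.
  have -> (M N : 'M[R]_q) : (M - N) i j = M i j - N i j by rewrite !mxE.
  by have [_] := expmx_sub_le A k i j tT; rewrite expmxE.
rewrite natrM -mulrA.
apply: (@le_trans _ _ (\sum_(i < q) \sum_(j < q) tail)).
  by apply: ler_sum => i _; apply: ler_sum => j _; exact: L_sub.
by rewrite !sumr_const !card_ord mulr_natl mulr_natl.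
Qed.

(** The interface to the exponential used from here on. [C] is chosen before [e], so errors of the
    form [C * e] can be made arbitrarily small. The fourth bound controls the defect of the section
    in its differential equation. *)
Lemma pexpmx_approx q (A : 'M[R]_q) T : 0 <= T ->
  exists2 C, 0 <= C & forall e, 0 < e -> exists k, forall t, `|t| <= T ->
    [/\ l1 (evalpmx (pexpmx A k) t) <= C,
        l1 (evalpmx (pexpmx A k.+1) t) <= C,
        l1 (expmx (t *: A)) <= C,
        l1 (evalpmx (pexpmx_term A k) t) <= e
      & l1 (expmx (t *: A) - evalpmx (pexpmx A k.+1) t) <= e].
Proof.
move=> T_ge0; pose s : R^nat := series (exp_coeff (l1 A * T)).
have aT_ge0 : 0 <= l1 A * T by rewrite mulr_ge0 ?l1_ge0.
have s_cvg : s @ \oo --> expR (l1 A * T) by exact: is_cvg_series_exp_coeff.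
have s_nd : nondecreasing_seq s.
  by apply: nondecreasing_series => i _ _; rewrite exp_coeff_ge0.
have s_le k : s k <= expR (l1 A * T).
  by apply: nondecreasing_cvgn_le => //; exact: is_cvg_series_exp_coeff.
have s_ge0 k : 0 <= s k.
  by apply: sumr_ge0 => i _; rewrite exp_coeff_ge0.
(* One constant for both kinds of bound: [q] for the sections, and [q * q * q] for the distance to
   the limit, where an entrywise error is summed over [q * q] entries. *)
pose c : R := q%:R + (q * q)%:R * q%:R.
have c_ge0 : 0 <= c by rewrite addr_ge0 // mulr_ge0.
have qc : q%:R <= c by rewrite lerDl mulr_ge0.
have pexp_le k t : `|t| <= T -> l1 (evalpmx (pexpmx A k) t) <= q%:R * s k.
  move=> tT; rewrite evalpmx_pexp (le_trans (l1_sum _ _)) // mulr_sumr.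
  by apply: ler_sum => i _; exact: l1_expmx_term.
have pexp_leC k t : `|t| <= T ->
    l1 (evalpmx (pexpmx A k) t) <= c * expR (l1 A * T).
  by move=> tT; rewrite (le_trans (pexp_le _ _ tT)) // ler_pM.
exists (c * expR (l1 A * T)); first by rewrite mulr_ge0 ?expR_ge0.
move=> e e_gt0.
have c1_gt0 : 0 < c + 1 by rewrite ltr_wpDl.
have /cvgrPdist_le/(_ (e / (c + 1))) := s_cvg.
rewrite divr_gt0 // => /(_ isT) [k _ k_large].
have tail_le l : (k <= l)%N -> c * (expR (l1 A * T) - s l) <= e.
  move=> kl; have := k_large l kl; rewrite /= ger0_norm ?subr_ge0 //.
  rewrite ler_pdivlMr //; apply: le_trans.
  by rewrite [leRHS]mulrC ler_wpM2r ?subr_ge0 // lerDl.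
exists k => t tT; split; try exact: pexp_leC.
- rewrite -(subrK (evalpmx (pexpmx A k) t) (expmx _)).
  rewrite (le_trans (l1D _ _)) //.
  have := lerD (l1_expmx_sub A k tT) (pexp_le k t tT); move/le_trans; apply.
  have := s_le k; have := s_ge0 k; rewrite -/s /c.
  have := ler0n R q; have : 0 <= (q * q)%:R * q%:R :> R by rewrite mulr_ge0.
  set x := _ * q%:R => x_ge0 q_ge0 sk_ge0 sk_le.
  have := mulr_ge0 x_ge0 sk_ge0; rewrite -subr_ge0 in sk_le.
  by have := mulr_ge0 q_ge0 sk_le; rewrite mulrA -/x; lra.
- apply: le_trans (tail_le k (leqnn k)).
  have -> : pexpmx_term A k = pexpmx A k.+1 - pexpmx A k.
    by rewrite pexpmxS addrC addKr.
  rewrite evalpmxB (le_trans (l1_series_sub A tT (leqnSn k))) //.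
  by rewrite ler_wpM2r // subr_ge0.
- apply: le_trans (tail_le k.+1 (leqnSn k)).
  rewrite (le_trans (l1_expmx_sub A k.+1 tT)) // mulrA ler_wpM2r ?subr_ge0 //.
  by rewrite lerDr.
Qed.

End MatrixExponential.

(** * Inverse of the exponential and monotonicity along the flow *)

Section Flow.
Context {R : realType}.

Lemma horner_le_linear (f : {poly R}) (e t : R) : 0 <= t ->
  (forall s, 0 <= s <= t -> f^`().[s] <= e) -> f.[t] <= f.[0] + e * t.
Proof.
move=> t_ge0 f'_le.
have f_derive (s : R) : is_derive s 1 (horner f) f^`().[s].
  by apply: DeriveDef; [exact: derivable_horner | rewrite -derive1E -derivE].
have [s s0t fE] := @MVT_segment R (horner f) (horner f^`()) 0 t t_ge0
  (fun s _ => f_derive s) (continuous_subspaceT (@continuous_horner _ f)).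
by rewrite -lerBlDl fE subr0 ler_wpM2r // f'_le // -in_itv.
Qed.

Lemma qf_le_linear q (X : 'M[{poly R}]_q) v e t : 0 <= t ->
  (forall s, 0 <= s <= t -> qf (evalpmx (derivpmx X) s) v <= e) ->
  qf (evalpmx X t) v <= qf (evalpmx X 0) v + e * t.
Proof.
move=> t_ge0 X'_le.
pose f := ((constpmx v)^T *m X *m constpmx v) 0 0.
have fE s : qf (evalpmx X s) v = f.[s].
  have -> : f.[s] = evalpmx ((constpmx v)^T *m X *m constpmx v) s 0 0.
    by rewrite [RHS]mxE.
  by rewrite !evalpmxE.
have evalE (Y : 'M[{poly R}]_1) s : evalpmx (derivpmx Y) s 0 0 = (Y 0 0)^`().[s].
  by rewrite !mxE.
have f'E s : qf (evalpmx (derivpmx X) s) v = f^`().[s].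
  have -> : f^`().[s] =
      evalpmx (derivpmx ((constpmx v)^T *m X *m constpmx v)) s 0 0.
    by rewrite evalE.
  rewrite !derivpmxM derivpmx_tr derivpmx_const trmx0 mul0mx add0r mulmx0 addr0.
  by rewrite !evalpmxE.
rewrite !fE; apply: horner_le_linear => // s st.
by rewrite -f'E X'_le.
Qed.

(** Lets approximation errors carry a fixed factor [c], by using [e / (c + 1)] in place of [e]. *)
Lemma ler_addgt0_scale (x y c : R) : 0 <= c ->
  (forall e, 0 < e -> x <= y + c * e) -> x <= y.
Proof.
move=> c_ge0 xy; apply/ler_addgt0Pr => e e_gt0.
have c1_gt0 : 0 < c + 1 by rewrite ltr_wpDl.
apply: le_trans (xy (e / (c + 1)) _) _; first by rewrite divr_gt0.
by rewrite lerD2l mulrCA ler_piMr ?(ltW e_gt0) // ler_pdivrMr // mul1r lerDl.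
Qed.

(** The product of the two Taylor sections equals the identity at time 0 and has a derivative of
    order [e], so it stays near the identity. Letting [e] tend to 0 gives the claim. *)
Lemma expmxN q (A : 'M[R]_q) t : 0 <= t ->
  expmx (t *: - A) *m expmx (t *: A) = 1%:M.
Proof.
move=> t_ge0; have [C C_ge0 approx] := pexpmx_approx A t_ge0.
have a_ge0 := l1_ge0 A.
apply/eqP; rewrite -subr_eq0; apply/eqP/matrixP => i j; rewrite [RHS]mxE.
apply/eqP; rewrite -normr_le0.
(* [C + C] accounts for replacing the two exponentials by sections, the remainder for the drift of
   the product of sections up to time [t]. *)
apply: (@ler_addgt0_scale _ _ (C + C + (l1 A * C + l1 A * C) * t)).
  by rewrite addr_ge0 // ?mulr_ge0 ?addr_ge0 ?mulr_ge0.
move=> e e_gt0; rewrite add0r.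
have [k k_approx] := approx e e_gt0.
pose X := pexpmx (- A) k.+1 *m pexpmx A k.+1.
have commN : constpmx A *m pexpmx (- A) k = pexpmx (- A) k *m constpmx A.
  by apply: oppr_inj; rewrite -mulNmx -mulmxN -constpmxN comm_pexp.
(* The leading terms cancel by commutation; only products with a last Taylor term remain. *)
have X'E : derivpmx X =
    pexpmx_term (- A) k *m (constpmx A *m pexpmx A k)
    - constpmx A *m pexpmx (- A) k *m pexpmx_term A k.
  rewrite /X derivpmxM !derivpmx_pexp (pexpmxS A) (pexpmxS (- A)) constpmxN mulNmx.
  rewrite mulNmx mulmxDr mulmxDl [pexpmx (- A) k *m (_ *m _)]mulmxA -commN.
  by rewrite opprD addrACA addNr add0r addrC.
have evalN B s : evalpmx (pexpmx_term (- B) k) s =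
    evalpmx (pexpmx_term B k) (- s).
  by rewrite !evalpmx_pexp_term scalerN scaleNr.
have X'_le s : 0 <= s <= t ->
    `|(X i j)^`().[s]| <= (l1 A * C + l1 A * C) * e.
  move=> /andP[s_ge0 st].
  have s_le : `|s| <= t by rewrite ger0_norm.
  have sN_le : `|- s| <= t by rewrite normrN.
  have [P_le _ _ t_le _] := k_approx s s_le.
  have [PN_le _ _ tN_le _] := k_approx (- s) sN_le.
  have -> : (X i j)^`().[s] = evalpmx (derivpmx X) s i j by rewrite !mxE.
  rewrite (le_trans (ler_coord_l1 _ _ _)) // X'E evalpmxB !evalpmxM !evalpmx_const.
  rewrite evalN evalpmx_pexpN (le_trans (l1B _ _)) // mulrDl lerD //.
    rewrite mulrC (le_trans (l1M _ _)) // ler_pM ?l1_ge0 //.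
    by rewrite (le_trans (l1M _ _)) // ler_wpM2l.
  rewrite (le_trans (l1M _ _)) // ler_pM ?l1_ge0 //.
  by rewrite (le_trans (l1M _ _)) // ler_wpM2l.
have X0 : (X i j).[0] = (1%:M : 'M[R]_q) i j.
  have -> : (X i j).[0] = evalpmx X 0 i j by rewrite [RHS]mxE.
  by rewrite evalpmxM !evalpmx_pexp0 mulmx1.
have Xt_le : `|(X i j).[t] - (1%:M : 'M[R]_q) i j| <=
    (l1 A * C + l1 A * C) * e * t.
  rewrite ler_norml -X0; apply/andP; split.
    have : (- X i j).[t] <= (- X i j).[0] + (l1 A * C + l1 A * C) * e * t.
      apply: horner_le_linear => // s /X'_le.
      by rewrite derivN hornerN ler_norml lerNl => /andP[].
    by rewrite !hornerN; lra.
  rewrite lerBlDl; apply: horner_le_linear => // s /X'_le.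
  by rewrite ler_norml => /andP[].
have t_le : `|t| <= t by rewrite ger0_norm.
have tN_le : `|- t| <= t by rewrite normrN.
have [_ E_le G_le _ GE_le] := k_approx t t_le.
have [_ EN_le F_le _ FE_le] := k_approx (- t) tN_le.
set F := expmx _; set G := expmx _.
have -> : (F *m G - 1%:M) i j =
    (F *m G - evalpmx X t) i j + ((X i j).[t] - (1%:M : 'M[R]_q) i j).
  rewrite [LHS]mxE [(_ - evalpmx X t) i j]mxE [(- 1%:M) i j]mxE.
  by rewrite [(- evalpmx X t) i j]mxE [evalpmx X t i j]mxE; ring.
rewrite (le_trans (ler_normD _ _)) // [leRHS]mulrDl; apply: lerD; last first.
  by rewrite (le_trans Xt_le) // mulrAC.
rewrite (le_trans (ler_coord_l1 _ _ _)) //.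
have -> : F *m G - evalpmx X t =
    (F - evalpmx (pexpmx (- A) k.+1) t) *m G
    + evalpmx (pexpmx (- A) k.+1) t *m (G - evalpmx (pexpmx A k.+1) t).
  by rewrite evalpmxM mulmxBl mulmxBr addrA subrK.
rewrite /F scalerN -scaleNr evalpmx_pexpN mulrDl (le_trans (l1D _ _)) //.
rewrite lerD // (le_trans (l1M _ _)) // ?[C * e]mulrC.
  by rewrite ler_pM ?l1_ge0.
by rewrite mulrC ler_pM ?l1_ge0.
Qed.

End Flow.

Section FlowDecay.
Context {R : realType}.

(** The derivative of [e^(At) S e^(A^T t)] is [e^(At) (S' + A S + S A^T) e^(A^T t)], hence
    nonpositive. This is carried out for a section [E] in place of the exponential, with errors
    proportional to [e]. *)
Lemma flow_decay q (A : 'M[R]_q) (S : 'M[{poly R}]_q) T :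
  (forall s, 0 <= s <= T -> forall v,
    qf (evalpmx (derivpmx S + (S *m (constpmx A)^T + constpmx A *m S)) s) v <= 0) ->
  forall t, 0 <= t <= T -> forall v,
  qf (expmx (t *: A) *m evalpmx S t *m (expmx (t *: A))^T) v <=
  qf (evalpmx S 0) v.
Proof.
move=> S_le t /andP[t_ge0 tT] v; have T_ge0 := le_trans t_ge0 tT.
have [C C_ge0 approx] := pexpmx_approx A T_ge0.
have [B B_ge0 S_bd] := evalpmx_bounded S T.
have a_ge0 := l1_ge0 A; have v_ge0 := sqn_ge0 v.
(* Up to the factor [e], [c1] bounds each of the two error terms in the derivative of [X], and [c2]
   each of the two made at time [t] when [E] replaces the exponential. *)
pose c1 := l1 A * B * C * sqn v; pose c2 := B * C * sqn v.
have c1_ge0 : 0 <= c1 by rewrite /c1 !mulr_ge0.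
have c2_ge0 : 0 <= c2 by rewrite /c2 !mulr_ge0.
apply: (@ler_addgt0_scale _ _ _ ((c1 + c1) * t + (c2 + c2))).
  by rewrite !addr_ge0 // mulr_ge0 // addr_ge0.
move=> e e_gt0; have [k k_approx] := approx e e_gt0.
set E := pexpmx A k.+1 in k_approx; set P := pexpmx A k in k_approx.
set tau := pexpmx_term A k in k_approx.
pose X := E *m S *m E^T.
(* Differentiating [E] produces the shorter section [P]; this restores [E] and isolates the defect
   [tau]. *)
have AP : constpmx A *m P = E *m constpmx A - constpmx A *m tau.
  by rewrite -comm_pexp -mulmxBr /E pexpmxS addrK.
have X'E : derivpmx X =
    E *m (derivpmx S + (S *m (constpmx A)^T + constpmx A *m S)) *m E^T
    - (constpmx A *m tau *m S *m E^T + E *m S *m (constpmx A *m tau)^T).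
  rewrite /X !derivpmxM derivpmx_tr derivpmx_pexp -/P AP.
  rewrite linearB /= (trmx_mul E) !mulmxDr !mulmxDl mulmxN !mulNmx !mulmxA.
  move: (E *m constpmx A *m S *m E^T) (constpmx A *m tau *m S *m E^T)
    (E *m derivpmx S *m E^T) (E *m S *m (constpmx A)^T *m E^T)
    (E *m S *m (constpmx A *m tau)^T)
    => x1 x2 x3 x4 x5.
  by apply/matrixP => i j; rewrite !mxE; ring.
have X_le : qf (evalpmx X t) v <= qf (evalpmx X 0) v + (c1 + c1) * e * t.
  apply: qf_le_linear => // s /andP[s_ge0 st].
  have sT : s <= T := le_trans st tT.
  have s_T : `|s| <= T by rewrite ger0_norm.
  have [P_le E_le _ t_le _] := k_approx s s_T.
  rewrite X'E evalpmxB qfB; set Y := evalpmx (E *m _ *m _) s.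
  have Y_le : qf Y v <= 0.
    rewrite /Y !evalpmxM evalpmx_tr -{1}[evalpmx E s]trmxK qf_congr.
    by apply: S_le; rewrite s_ge0.
  rewrite -[leRHS]add0r lerD // -qfN (le_trans (qf_le_l1 _ _)) // l1N.
  have St_le : l1 (evalpmx S s) <= B := S_bd s s_T.
  rewrite evalpmxD (le_trans (ler_wpM2r v_ge0 (l1D _ _))) // mulrDl [leRHS]mulrDl.
  have b1 : l1 A * e * B * C * sqn v <= c1 * e by rewrite /c1; lra.
  rewrite lerD // (le_trans _ b1) // ler_wpM2r //.
    rewrite !evalpmxM evalpmx_const evalpmx_tr.
    rewrite (le_trans (l1M _ _)) // l1_tr ler_pM ?l1_ge0 //.
    rewrite (le_trans (l1M _ _)) // ler_pM ?l1_ge0 //.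
    by rewrite (le_trans (l1M _ _)) // ler_wpM2l.
  rewrite !evalpmxM evalpmx_tr evalpmxM evalpmx_const.
  rewrite (le_trans (l1M _ _)) // l1_tr mulrC -mulrA ler_pM ?l1_ge0 //.
    by rewrite (le_trans (l1M _ _)) // ler_wpM2l.
  by rewrite (le_trans (l1M _ _)) // mulrC ler_pM ?l1_ge0.
have X0 : evalpmx X 0 = evalpmx S 0.
  by rewrite /X !evalpmxM evalpmx_tr evalpmx_pexp0 trmx1 mul1mx mulmx1.
have t_T : `|t| <= T by rewrite ger0_norm.
have [_ E_le F_le _ FE_le] := k_approx t t_T.
have St_le : l1 (evalpmx S t) <= B := S_bd t t_T.
set F := expmx _ in F_le FE_le *.
have FE : F *m evalpmx S t *m F^T = evalpmx X t +
    ((F - evalpmx E t) *m evalpmx S t *m F^T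
     + evalpmx E t *m evalpmx S t *m (F - evalpmx E t)^T).
  rewrite /X !evalpmxM evalpmx_tr linearB /= mulmxBr !mulmxBl.
  by rewrite subrKA addrC subrK.
rewrite FE qfD mulrDl -X0 addrA; apply: lerD.
  by rewrite (le_trans X_le) // lerD2l mulrAC.
rewrite (le_trans (qf_le_l1 _ _)) //.
rewrite (le_trans (ler_wpM2r v_ge0 (l1D _ _))) // mulrDl [leRHS]mulrDl.
have b2 : e * B * C * sqn v <= c2 * e by rewrite /c2; lra.
rewrite lerD // (le_trans _ b2) // ler_wpM2r //.
  rewrite (le_trans (l1M _ _)) // l1_tr ler_pM ?l1_ge0 //.
  by rewrite (le_trans (l1M _ _)) // ler_pM ?l1_ge0.
rewrite (le_trans (l1M _ _)) // l1_tr mulrC -mulrA ler_pM ?l1_ge0 //.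
by rewrite (le_trans (l1M _ _)) // mulrC ler_pM ?l1_ge0.
Qed.

End FlowDecay.

(** * Certificates for a single mode *)

Section Certificates.
Context {R : realType}.

Lemma horner_gpoly (T t : R) : (gpoly T).[t] = t * (T - t).
Proof. by rewrite /gpoly !hornerE. Qed.

Lemma horner_hpoly (a b t : R) : (hpoly a b).[t] = (t - a) * (b - t).
Proof. by rewrite /hpoly !hornerE. Qed.

(* [w = - X M v] in the block inequality, with [X = e^(A^T t) Q e^(A t)], which
   satisfies [X S(t) X <= X]. *)
Lemma lmi_of_certificate q (A M Pe Q : 'M[R]_q) (S Gamma Delta : 'M[{poly R}]_q)
    Tmin Tmax :
  0 <= Tmin -> Q^T = Q -> SOSmx Gamma -> SOSmx Delta ->
  SOSmx (- derivpmx S - (S *m (constpmx A)^T + constpmx A *m S)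
         - gpoly Tmax *: Gamma) ->
  SOSmx (block_mx (constpmx Pe) (constpmx M)^T
                  (constpmx M) (S - hpoly Tmin Tmax *: Delta)) ->
  (forall w, qf (evalpmx S 0) (Q *m w) <= qf Q w) ->
  forall t, Tmin <= t <= Tmax -> forall v,
  qf ((expmx (t *: A))^T *m Q *m expmx (t *: A)) (M *m v) <= qf Pe v.
Proof.
move=> Tmin_ge0 Q_sym Gamma_sos Delta_sos S_sos block_sos S0_le t.
move=> /andP[t_ge t_le] v; have t_ge0 := le_trans Tmin_ge0 t_ge.
set G := expmx _; set X := _ *m Q *m _.
have X_sym : X^T = X by rewrite /X !trmx_mul trmxK Q_sym mulmxA.
have decay w : qf (G *m evalpmx S t *m G^T) w <= qf (evalpmx S 0) w.
  apply: (@flow_decay _ _ _ _ Tmax); last by rewrite t_ge0.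
  move=> s /andP[s_ge0 s_le] u.
  have := SOSmx_eval s u S_sos.
  rewrite -opprD evalpmxB qfB evalpmxN qfN evalpmxZ qfZ horner_gpoly.
  have := mulr_ge0 (mulr_ge0 s_ge0 (_ : 0 <= Tmax - s)) (SOSmx_eval s u Gamma_sos).
  rewrite subr_ge0 => /(_ s_le); lra.
set u := M *m v; pose w := - (X *m u).
have := SOSmx_eval t (col_mx v w) block_sos.
rewrite evalpmx_block evalpmx_tr !evalpmx_const qf_block evalpmxB qfB.
rewrite evalpmxZ qfZ horner_hpoly.
have -> : (w^T *m M *m v) 0 0 = - qf X u.
  by rewrite /w -mulmxA linearN /= trmx_mul X_sym mulNmx mxE.
have Sw_le : qf (evalpmx S t) w <= qf X u.
  have -> : qf (evalpmx S t) w = qf (G *m evalpmx S t *m G^T) (Q *m (G *m u)).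
    rewrite -{1}[G]trmxK qf_congr !mulmxA -/X /w.
    by rewrite /qf [(- _)^T]linearN /= !mulNmx mulmxN opprK /u !mulmxA.
  by rewrite (le_trans (decay _)) // (le_trans (S0_le _)) // -qf_congr.
have : 0 <= (t - Tmin) * (Tmax - t) * qf (evalpmx Delta t) w.
  by rewrite !mulr_ge0 ?subr_ge0 // SOSmx_eval.
by lra.
Qed.

(** For [L = E Y E^T], with [E] a section, the first bound compares [L] with the exact congruence;
    the second bounds the matrix which, added to its transpose, is the defect of
    [L' = A L + L A^T]. *)
Lemma pexpmx_congr_approx q (A Y : 'M[R]_q) T e : 0 <= T -> 0 < e ->
  exists k, forall t, `|t| <= T ->
    l1 (expmx (t *: A) *m Y *m (expmx (t *: A))^T
        - evalpmx (pexpmx A k.+1 *m constpmx Y *m (pexpmx A k.+1)^T) t) <= e /\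
    l1 (evalpmx (constpmx A *m pexpmx_term A k *m constpmx Y
                   *m (pexpmx A k.+1)^T) t) <= e.
Proof.
move=> T_ge0 e_gt0; have [C C_ge0 approx] := pexpmx_approx A T_ge0.
have a_ge0 := l1_ge0 A; have y_ge0 := l1_ge0 Y.
pose r := l1 Y * C + C * l1 Y + l1 A * l1 Y * C.
have r_ge0 : 0 <= r by rewrite /r !addr_ge0 ?mulr_ge0 ?mulr_ge0.
have r1_gt0 : 0 < r + 1 by rewrite ltr_wpDl.
have e0_gt0 : 0 < e / (r + 1) by rewrite divr_gt0.
have [k k_approx] := approx _ e0_gt0; exists k => t tT.
have [_ E_le F_le tau_le FE_le] := k_approx t tT.
set e0 := e / _ in e0_gt0 tau_le FE_le.
have e0E : e0 * (r + 1) = e by rewrite /e0 divfK // gt_eqF.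
clearbody e0; have e0_ge0 := ltW e0_gt0.
set F := expmx _ in F_le FE_le *; set E := pexpmx A k.+1 in E_le FE_le *.
have YC_ge0 : 0 <= e0 * (l1 Y * C) by rewrite !mulr_ge0 ?e0_ge0.
have aYC_ge0 : 0 <= e0 * (l1 A * l1 Y * C) by rewrite !mulr_ge0 ?e0_ge0.
split; rewrite !evalpmxM !evalpmx_const evalpmx_tr.
  have -> : F *m Y *m F^T - evalpmx E t *m Y *m (evalpmx E t)^T =
      (F - evalpmx E t) *m Y *m F^T + evalpmx E t *m Y *m (F - evalpmx E t)^T.
    by rewrite linearB /= mulmxBr !mulmxBl addrA subrK.
  apply: le_trans (l1D _ _) _.
  have h1 : l1 ((F - evalpmx E t) *m Y *m F^T) <= e0 * l1 Y * C.
    rewrite (le_trans (l1M _ _)) // l1_tr ler_pM ?l1_ge0 //.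
    by rewrite (le_trans (l1M _ _)) // ler_wpM2r.
  have h2 : l1 (evalpmx E t *m Y *m (F - evalpmx E t)^T) <= C * l1 Y * e0.
    rewrite (le_trans (l1M _ _)) // l1_tr ler_pM ?l1_ge0 //.
    by rewrite (le_trans (l1M _ _)) // ler_wpM2r.
  by rewrite -e0E /r; lra.
have h : l1 (A *m evalpmx (pexpmx_term A k) t *m Y *m (evalpmx E t)^T) <=
    l1 A * e0 * l1 Y * C.
  rewrite (le_trans (l1M _ _)) // l1_tr ler_pM ?l1_ge0 //.
  rewrite (le_trans (l1M _ _)) // ler_wpM2r //.
  by rewrite (le_trans (l1M _ _)) // ler_wpM2l.
by rewrite (le_trans h) // -e0E /r; lra.
Qed.

(** With [F] and [G] the exponentials at [- A] and [A], [F G = 1] gives [v = G^T (F^T v)], so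
    [F^T v] cannot be small compared with [v], uniformly in [t]. *)
Lemma expmx_congr_posdef q (A Y : 'M[R]_q) T : 0 <= T -> posdefmx Y ->
  exists2 c, 0 < c & forall t, 0 <= t <= T -> forall v,
    c * sqn v <= qf (expmx (t *: - A) *m Y *m (expmx (t *: - A))^T) v.
Proof.
move=> T_ge0 /posdefmx_ge [c c_gt0 Y_ge].
have [C C_ge0 /(_ 1 ltr01) [k k_approx]] := pexpmx_approx A T_ge0.
have C1_gt0 : 0 < C * C + 1 by rewrite ltr_wpDl // mulr_ge0.
exists (c / (C * C + 1)); first by rewrite divr_gt0.
move=> t /andP[t_ge0 tT] v.
have t_T : `|t| <= T by rewrite ger0_norm.
have [_ _ G_le _ _] := k_approx t t_T.
set F := expmx _; set G := expmx _ in G_le.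
rewrite -{1}[F]trmxK qf_congr (le_trans _ (Y_ge _)) // -mulrA.
rewrite ler_wpM2l ?(ltW c_gt0) // mulrC ler_pdivrMr // mulrC.
have {1}-> : v = G^T *m (F^T *m v).
  by rewrite mulmxA -trmx_mul expmxN // trmx1 mul1mx.
rewrite (le_trans (sqn_mulmx_le _ _)) // ler_wpM2r ?sqn_ge0 //.
rewrite (le_trans (l1M _ _)) // trmxK l1_tr.
by rewrite (@le_trans _ _ (C * C)) ?lerDl // ler_pM ?l1_ge0.
Qed.

Lemma qf_sub_sym q (Y : 'M[R]_q) a b : Y^T = Y ->
  qf Y (a - b) = qf Y a - 2%:R * (a^T *m Y *m b) 0 0 + qf Y b.
Proof.
move=> Y_sym; rewrite /qf [(a - b)^T]linearB /= mulmxBr !mulmxBl.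
have -> : b^T *m Y *m a = (a^T *m Y *m b)^T.
  by rewrite !trmx_mul trmxK Y_sym mulmxA.
move: (a^T *m Y *m a) (a^T *m Y *m b) (b^T *m Y *m b) => x y z.
by rewrite !mxE; ring.
Qed.

(* Expand [0 <= (kappa z - Q G M v)^T Q^-1 (kappa z - Q G M v)] at
   [z = F^T w] and [v = Pe^-1 M^T w], where [F G = 1]. *)
Lemma schur_complement_le q (F G M Pe Q : 'M[R]_q) (kappa : R) :
  F *m G = 1%:M -> posdefmx Pe -> posdefmx Q -> 0 < kappa ->
  (forall v, qf (G^T *m Q *m G) (M *m v) <= kappa * qf Pe v) ->
  forall w, qf (M *m invmx Pe *m M^T) w <=
            kappa * qf (F *m invmx Q *m F^T) w.
Proof.
move=> FG Pe_pd Q_pd kappa_gt0 lmi w.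
have Pe_unit := posdefmx_unit Pe_pd; have Q_unit := posdefmx_unit Q_pd.
have [Pe_sym _] := Pe_pd; have [Q_sym _] := Q_pd.
pose z := F^T *m w; pose v := invmx Pe *m (M^T *m w).
set beta := qf _ w.
have wMv : (w^T *m M *m v) 0 0 = beta by rewrite /beta /qf /v !mulmxA.
have Pe_v : qf Pe v = beta.
  rewrite /v -qf_congr tr_invmx // mulVmx // mul1mx.
  by rewrite -qf_congr trmxK.
have zQ : qf (invmx Q) z = qf (F *m invmx Q *m F^T) w.
  by rewrite /z -qf_congr trmxK.
have := posdefmx_qf (kappa *: z - Q *m (G *m (M *m v))) (posdefmx_inv Q_pd).
rewrite qf_sub_sym; last exact: tr_invmx.
have -> : qf (invmx Q) (Q *m (G *m (M *m v))) = qf (G^T *m Q *m G) (M *m v).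
  by rewrite -qf_congr Q_sym mulmxV // mul1mx qf_congr.
have -> : qf (invmx Q) (kappa *: z) = kappa * (kappa * qf (F *m invmx Q *m F^T) w).
  rewrite -zQ {1}/qf [(kappa *: z)^T]linearZ /= -!scalemxAl -scalemxAr.
  by have scE (x : R) (X : 'M[R]_1) : (x *: X) 0 0 = x * X 0 0;
    [rewrite mxE | rewrite !scE].
have -> : ((kappa *: z)^T *m invmx Q *m (Q *m (G *m (M *m v)))) 0 0 = kappa * beta.
  rewrite [(kappa *: z)^T]linearZ /= -!scalemxAl [LHS]mxE mulmxA mulmxKV //.
  by rewrite /z trmx_mul trmxK mulmxA -(mulmxA _ F) FG mulmx1 mulmxA wMv.
have := lmi v; rewrite Pe_v => lmi_v ge0.
suff : kappa * (kappa * qf (F *m invmx Q *m F^T) w - beta) >= 0.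
  by rewrite pmulr_rge0 // subr_ge0.
by rewrite mulrBr; lra.
Qed.

(** The slack [1 - kappa] is spent on the factor [sigma = 1 - delta t]: its negative slope makes the
    flow inequality strict, while it stays far enough above [kappa] to keep the Schur complement
    positive definite. *)
Lemma certificate_of_lmi q (A M Pe Q : 'M[R]_q) Tmin Tmax kappa :
  0 <= Tmin -> Tmin <= Tmax -> posdefmx Pe -> posdefmx Q -> 0 < kappa < 1 ->
  (forall t, Tmin <= t <= Tmax -> forall v,
    qf ((expmx (t *: A))^T *m Q *m expmx (t *: A)) (M *m v) <= kappa * qf Pe v) ->
  exists S Gamma Delta : 'M[{poly R}]_q,
  [/\ S^T = S /\ evalpmx S 0 = invmx Q, SOSmx Gamma, SOSmx Delta,
      SOSmx (- derivpmx S - (S *m (constpmx A)^T + constpmx A *m S)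
             - gpoly Tmax *: Gamma)
    & SOSmx (block_mx (constpmx Pe) (constpmx M)^T
                      (constpmx M) (S - hpoly Tmin Tmax *: Delta))].
Proof.
move=> Tmin_ge0 TT Pe_pd Q_pd /andP[kappa_gt0 kappa_lt1] lmi.
have Tmax_ge0 := le_trans Tmin_ge0 TT.
set Y := invmx Q; have Y_pd : posdefmx Y := posdefmx_inv Q_pd.
have [Y_sym _] := Y_pd; have [Pe_sym _] := Pe_pd.
have Pe_unit := posdefmx_unit Pe_pd.
have [c c_gt0 FYF_ge] := expmx_congr_posdef A Tmax_ge0 Y_pd.
have T1_gt0 : 0 < Tmax + 1 by rewrite ltr_wpDl.
(* Makes [delta * t] at most [(1 - kappa) / 2] on [0, Tmax], so that [sigma] is at least
   [(1 + kappa) / 2] there; also [delta <= 1]. *)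
pose delta := (1 - kappa) / 2 / (Tmax + 1).
have kappa'_gt0 : 0 < (1 - kappa) / 2 by rewrite divr_gt0 // subr_gt0.
have delta_gt0 : 0 < delta by rewrite divr_gt0.
have deltaT : delta * (Tmax + 1) = (1 - kappa) / 2.
  by rewrite divfK // gt_eqF.
clearbody delta; have deltaT_ge0 : 0 <= delta * Tmax by rewrite mulr_ge0 // ltW.
(* With this accuracy the flow form is at least [delta * c - 3 * e = 5 * e] times [sqn v], which
   exceeds the required [delta * c / 2 = 4 * e]. *)
have e_gt0 : 0 < delta * c / 8 by rewrite !divr_gt0 ?mulr_gt0.
have [k k_approx] := pexpmx_congr_approx (- A) Y Tmax_ge0 e_gt0.
set e := _ / 8 in e_gt0 k_approx.
set E := pexpmx (- A) k.+1 in k_approx.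
set L := E *m constpmx Y *m E^T in k_approx.
set a := constpmx (- A) in k_approx.
set tau := a *m _ *m _ *m _ in k_approx.
pose sigma : {poly R} := 1 - delta *: 'X.
pose S := sigma *: L.
have L_sym : L^T = L by rewrite /L !trmx_mul trmxK -constpmx_tr Y_sym mulmxA.
have S_sym : S^T = S by rewrite /S linearZ /= L_sym.
have sigmaE t : sigma.[t] = 1 - delta * t by rewrite /sigma !hornerE.
have sigma_bd t : 0 <= t <= Tmax -> (1 + kappa) / 2 <= sigma.[t] <= 1.
  move=> /andP[t_ge0 tT]; rewrite sigmaE; have := ltW delta_gt0 => d_ge0.
  have := ler_wpM2l d_ge0 tT; have := mulr_ge0 d_ge0 t_ge0.
  by move=> ? ?; apply/andP; split; lra.
have L_ge t : 0 <= t <= Tmax -> forall v,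
    qf (expmx (t *: - A) *m Y *m (expmx (t *: - A))^T) v - e * sqn v <=
    qf (evalpmx L t) v <=
    qf (expmx (t *: - A) *m Y *m (expmx (t *: - A))^T) v + e * sqn v.
  move=> /andP[t_ge0 tT] v; have t_T : `|t| <= Tmax by rewrite ger0_norm.
  have [L_le _] := k_approx t t_T.
  have := le_trans (normr_qf _ v) (ler_wpM2r (sqn_ge0 v) L_le).
  by rewrite qfB ler_norml => /andP[? ?]; apply/andP; split; lra.
(* The terms [a L] and [L a^T] cancel. There remain the gain [delta L] from the slope of [sigma] and
   the truncation defect [tau] with its transpose. *)
have derivE : - derivpmx S - (S *m (constpmx A)^T + constpmx A *m S) =
    delta%:P *: L + sigma *: (tau + tau^T).
  have -> : constpmx A = - a by rewrite /a constpmxN opprK.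
  have aP : a *m pexpmx (- A) k = a *m E - a *m pexpmx_term (- A) k.
    by rewrite -mulmxBr /E pexpmxS addrK.
  have LE : derivpmx L = (a *m E - a *m pexpmx_term (- A) k) *m constpmx Y *m E^T
      + E *m constpmx Y *m (a *m E - a *m pexpmx_term (- A) k)^T.
    rewrite /L !derivpmxM derivpmx_const mulmx0 addr0 derivpmx_tr.
    by rewrite derivpmx_pexp -/a aP.
  have tau_tr : tau^T = E *m constpmx Y *m (a *m pexpmx_term (- A) k)^T.
    by rewrite /tau !trmx_mul trmxK -[in LHS]constpmx_tr Y_sym !mulmxA.
  have sigma' : sigma^`() = - delta%:P.
    by rewrite derivB derivC derivZ derivX sub0r alg_polyC.
  have SaT : S *m (- a)^T = - (sigma *: (L *m a^T)).
    by rewrite linearN /= mulmxN -scalemxAl.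
  have aS : - a *m S = - (sigma *: (a *m L)) by rewrite mulNmx -scalemxAr.
  rewrite SaT aS /S derivpmxZ sigma' LE tau_tr.
  rewrite [(_ - _)^T]linearB /= [(a *m E)^T]trmx_mul !mulmxBl !mulmxBr.
  rewrite {2 3}/L !mulmxA -/tau.
  move: (tau) (L) (a *m E *m _ *m _) (_ *m E^T *m a^T) (_ *m (_ *m _)^T).
  move=> x1 x2 x3 x4 x5.
  by apply/matrixP => i j; rewrite !mxE; ring.
have flow_pd : quadmod (('X - 0%:P) * (Tmax%:P - 'X))
    (- derivpmx S - (S *m (constpmx A)^T + constpmx A *m S)).
  apply: (@posdef_quadmod _ _ _ _ _ (delta * c / 2)) => //.
  - rewrite derivE linearD /= !linearZ /= L_sym linearD /= trmxK.
    by rewrite [_ + tau]addrC.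
  - by rewrite divr_gt0 // mulr_gt0.
  move=> t t0T v; have /andP[L_lo L_hi] := L_ge t t0T v.
  have /andP[s_lo s_hi] := sigma_bd t t0T.
  have /andP[t_ge0 tT] := t0T; have t_T : `|t| <= Tmax by rewrite ger0_norm.
  have [_ tau_le] := k_approx t t_T.
  rewrite derivE evalpmxD !evalpmxZ evalpmxD evalpmx_tr hornerC.
  rewrite !(qfD, qfZ) qf_tr.
  set z := qf (expmx _ *m _ *m _) v in L_lo L_hi.
  have z_ge : c * sqn v <= z := FYF_ge t t0T v.
  have tau_v : `|qf (evalpmx tau t) v| <= e * sqn v.
    exact: le_trans (normr_qf _ v) (ler_wpM2r (sqn_ge0 v) tau_le).
  have s_tau : `|sigma.[t] * qf (evalpmx tau t) v| <= e * sqn v.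
    rewrite normrM -[leRHS]mul1r ler_pM // ger0_norm //.
    by rewrite (le_trans _ s_lo) // divr_ge0 // addr_ge0 // ltW.
  have v_ge0 := sqn_ge0 v; have e_ge0 := ltW e_gt0.
  have ev_ge0 := mulr_ge0 e_ge0 v_ge0.
  have dc : delta * c * sqn v = 8 * (e * sqn v).
    by rewrite mulrA [8 * e]mulrC /e divfK.
  have d_le1 : delta <= 1 by lra.
  have dL := ler_wpM2l (ltW delta_gt0) L_lo.
  have dz := ler_wpM2l (ltW delta_gt0) z_ge.
  have de := ler_wpM2r ev_ge0 d_le1.
  move: s_tau; rewrite ler_norml => /andP[s_tau _]; lra.
(* By [schur_complement_le] the subtracted term is at most [kappa] times the exact congruence,
   against at least [(1 + kappa) / 2] in [S]. Half of this gap absorbs the error [e]. *)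
have schur_pd : quadmod (hpoly Tmin Tmax)
    (S - constpmx (M *m invmx Pe *m M^T)).
  apply: (@posdef_quadmod _ _ _ _ _ ((1 - kappa) / 4 * c)) => //.
  - rewrite linearB /= S_sym -constpmx_tr !trmx_mul trmxK tr_invmx //.
    by rewrite mulmxA.
  - by rewrite mulr_gt0 // divr_gt0 // subr_gt0.
  move=> t tTT v; have /andP[t_ge tT] := tTT.
  have t_ge0 := le_trans Tmin_ge0 t_ge.
  have t0T : 0 <= t <= Tmax by rewrite t_ge0.
  have /andP[L_lo L_hi] := L_ge t t0T v.
  have /andP[s_lo s_hi] := sigma_bd t t0T.
  have := schur_complement_le (expmxN A t_ge0) Pe_pd Q_pd kappa_gt0 (lmi t tTT) v.
  have := FYF_ge t t0T v.
  rewrite evalpmxB evalpmx_const evalpmxZ qfB qfZ -/Y.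
  set z := qf (expmx _ *m _ *m _) v in L_lo L_hi *; set y := qf (_ *m _) v.
  set l := qf (evalpmx L t) v in L_lo L_hi *.
  move=> z_ge y_le; have v_ge0 := sqn_ge0 v.
  have s_ge0 : 0 <= sigma.[t].
    by rewrite (le_trans _ s_lo) // divr_ge0 // addr_ge0 // ltW.
  have z_ge0 : 0 <= z by rewrite (le_trans _ z_ge) // mulr_ge0 // ltW.
  have ev_ge0 : 0 <= e * sqn v by rewrite mulr_ge0 // ltW.
  have h1 := ler_wpM2l s_ge0 L_lo.
  have h2 := ler_wpM2r ev_ge0 s_hi.
  have h3 := ler_wpM2r z_ge0 s_lo.
  have h4 := ler_wpM2l (ltW kappa'_gt0) z_ge.
  have d_le : delta <= (1 - kappa) / 2 by lra.
  have cv_ge0 : 0 <= c * sqn v by rewrite mulr_ge0 // ltW.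
  have h5 := ler_wpM2r cv_ge0 d_le.
  have ev : 8 * (e * sqn v) = delta * (c * sqn v).
    by rewrite mulrA [8 * e]mulrC /e divfK // mulrA.
  have k_ge0 := mulr_ge0 (ltW kappa'_gt0) cv_ge0.
  lra.
have [G0 [Gamma [G0_sos Gamma_sos GE]]] := flow_pd.
have [D0 [Delta [D0_sos Delta_sos DE]]] := schur_pd.
exists S, Gamma, Delta; split=> //.
- split=> //; rewrite evalpmxZ sigmaE mulr0 subr0 scale1r.
  by rewrite !evalpmxM evalpmx_tr evalpmx_pexp0 trmx1 mul1mx mulmx1 evalpmx_const.
- by rewrite GE /gpoly polyC0 subr0 addrK.
have -> : S - hpoly Tmin Tmax *: Delta =
    D0 + constpmx (M *m invmx Pe *m M^T).
  by rewrite -[S](subrK (constpmx (M *m invmx Pe *m M^T))) DE addrAC addrK.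
(* Block elimination with pivot [Pe]: the block matrix is [N^T Pe N] plus the Schur complement
   remainder [D0] placed in the lower right corner. *)
pose N := row_mx 1%:M (constpmx (invmx Pe *m M^T)).
have -> : block_mx (constpmx Pe) (constpmx M)^T (constpmx M)
      (D0 + constpmx (M *m invmx Pe *m M^T)) =
    N^T *m constpmx Pe *m N + (row_mx 0 1%:M)^T *m D0 *m row_mx 0 1%:M.
  rewrite /N !tr_row_mx !trmx1 trmx0 !mul_col_mx !mul_mx_row -!block_mxEv add_block_mx.
  rewrite !mul1mx !mul0mx !mulmx1 !mulmx0 !addr0.
  rewrite -!constpmx_tr -!constpmxM trmx_mul trmxK tr_invmx // !mulmxA.
  by rewrite mulmxV // mul1mx mulmxKV // [D0 + _]addrC.
apply: SOSmxD; apply: SOSmx_congr => //.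
exact: SOSmx_const_posdef.
Qed.

End Certificates.

(** * Coupling of the modes *)

Section Coupling.
Context {R : realType}.

Lemma posdefmx_mxdiag N q (D : 'I_N -> 'M[R]_q) :
  (forall j, posdefmx (D j)) -> posdefmx (\mxdiag_(j < N) D j).
Proof.
move=> D_pd; split=> [|v v0].
  by rewrite tr_mxdiag; apply: eq_mxdiag => j; have [] := D_pd j.
rewrite -[v]submxcolK tr_mxcol mul_mxrow_mxdiag mul_mxrow_mxcol summxE.
rewrite lt_def sumr_ge0 ?andbT => [|j _]; last exact: posdefmx_qf.
apply: contra v0; rewrite psumr_eq0 => [|j _]; last exact: posdefmx_qf.
move=> /allP D0; rewrite -[v]submxcolK -mxcol0; apply/eqP/eq_mxcol => j.
apply/eqP/negPn/negP => vj0.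
have := D0 j (mem_index_enum _); have [_ D_gt0] := D_pd j.
by rewrite gt_eqF // D_gt0.
Qed.

Lemma col_stochastic_sum N (Pi : 'M[R]_N) i :
  col_stochastic Pi -> \sum_j Pi j i = 1.
Proof.
move=> [_ /matrixP /(_ 0 i)]; rewrite !mxE => <-.
by apply: eq_bigr => j _; rewrite mxE mul1r.
Qed.

(** Were the form zero at some nonzero [v], every weight would vanish, contradicting that the
    weights of column [i] sum to 1. *)
Lemma posdefmx_convex N q (Pi : 'M[R]_N) (P : 'I_N -> 'M[R]_q) i :
  col_stochastic Pi -> (forall j, posdefmx (P j)) ->
  posdefmx (\sum_j Pi j i *: P j).
Proof.
move=> Pi_st P_pd; have Pi_sum := col_stochastic_sum i Pi_st.
have [Pi_ge0 _] := Pi_st; split=> [|v v0].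
  rewrite raddf_sum; apply: eq_bigr => j _.
  by rewrite /= [LHS]linearZ /=; have [-> _] := P_pd j.
have P_gt0 j : 0 < qf (P j) v by have [_ ->] := P_pd j.
rewrite -[X in 0 < X]/(qf _ _) qf_sum lt_def sumr_ge0 ?andbT => [|j _]; last first.
  by rewrite qfZ mulr_ge0 // ltW.
apply/negP; rewrite psumr_eq0 => [|j _]; last by rewrite qfZ mulr_ge0 // ltW.
move=> /allP P0; have /eqP := Pi_sum; rewrite big1 ?[0 == _]eq_sym ?oner_eq0 //.
move=> j _; have := P0 j (mem_index_enum _); rewrite /= qfZ mulf_eq0.
by rewrite [qf _ _ == 0]gt_eqF // orbF => /eqP.
Qed.

Section CouplingMatrix.
Variables (N q : nat) (Pi : 'M[R]_N) (P : 'I_N -> 'M[R]_q) (i : 'I_N).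
Hypotheses (Pi_st : col_stochastic Pi) (P_pd : forall j, posdefmx (P j)).

Let Q := \sum_j Pi j i *: invmx (P j).
(** This is [D^-1 V]. The square roots of the weights recombine in [V^T Z = Z^T D Z = Q]. *)
Let Z : 'M[R]_(\sum_(j < N) q, q) :=
  \mxcol_(j < N) (Num.sqrt (Pi j i) *: invmx (P j)).
Let D : 'M[R]_(\sum_(j < N) q) := \mxdiag_(j < N) P j.
Let V : 'M[R]_(\sum_(j < N) q, q) := Vmx q Pi i.

Let Q_pd : posdefmx Q.
Proof. by apply: posdefmx_convex => // j; apply: posdefmx_inv. Qed.

Let DZ : D *m Z = V.
Proof.
rewrite /D /Z mul_mxdiag_mxcol; apply: eq_mxcol => j.
by rewrite -scalemxAr mulmxV ?posdefmx_unit // scalemx1.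
Qed.

Let VtZ : V^T *m Z = Q.
Proof.
rewrite /V /Vmx tr_mxcol mul_mxrow_mxcol; apply: eq_bigr => j _.
have [Pi_ge0 _] := Pi_st.
by rewrite tr_scalar_mx mul_scalar_mx scalerA -expr2 sqr_sqrtr.
Qed.

Let ZtDZ : Z^T *m D *m Z = Q.
Proof.
rewrite -mulmxA DZ; apply: trmx_inj; rewrite trmx_mul trmxK VtZ.
by have [->] := Q_pd.
Qed.

(** Test the constraint at [Z w]: the term in [D] becomes [qf Q w] and [V^T Z w] becomes [Q w]. *)
Lemma coupling_le (S0 : 'M[R]_q) :
  SOSmx (constpmx (D - V *m S0 *m V^T)) ->
  forall w, qf S0 (Q *m w) <= qf Q w.
Proof.
move=> D_sos w; have := SOSmx_eval 0 (Z *m w) D_sos.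
rewrite evalpmx_const qfB -[qf D _]qf_congr ZtDZ.
by rewrite -{1}[V]trmxK qf_congr mulmxA VtZ subr_ge0.
Qed.

(* [D - V Q^-1 V^T = H^T D H] for [H = 1 - Z Q^-1 V^T]. *)
Lemma coupling_SOS : SOSmx (constpmx (D - V *m invmx Q *m V^T)).
Proof.
have [Q_sym _] := Q_pd; have Q_unit := posdefmx_unit Q_pd.
have D_pd : posdefmx D by apply: posdefmx_mxdiag.
have [D_sym _] := D_pd.
pose H := 1%:M - Z *m invmx Q *m V^T.
have -> : D - V *m invmx Q *m V^T = H^T *m D *m H.
  have HtD : H^T *m D = D - V *m invmx Q *m V^T.
    apply: trmx_inj; rewrite trmx_mul trmxK D_sym /H mulmxBr mulmx1 !mulmxA DZ.
    by rewrite linearB /= D_sym !trmx_mul trmxK tr_invmx // mulmxA.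
  rewrite HtD /H mulmxBr mulmx1 mulmxBl !mulmxA DZ -[_ *m V^T *m Z]mulmxA VtZ.
  by rewrite mulmxKV // subrr subr0.
rewrite !constpmxM constpmx_tr; apply: SOSmx_congr.
exact: SOSmx_const_posdef.
Qed.

End CouplingMatrix.

Lemma degpmx_le_exists q (X : 'M[{poly R}]_q) :
  exists d, forall k, (d <= k)%N -> degpmx_le k X.
Proof.
exists (\max_i \max_j size (X i j))%N => k dk i j.
apply: leq_trans (leqW dk); apply: leq_trans (leq_bigmax i).
exact: (leq_bigmax j).
Qed.

Lemma qf_lmi q (Jb G Q P : 'M[R]_q) eps v :
  qf (Jb^T *m G^T *m Q *m G *m Jb - P + eps%:M) v =
  qf (G^T *m Q *m G) (Jb *m v) - qf P v + eps * sqn v.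
Proof. by rewrite qfD qfB qf_scalar -qf_congr !mulmxA. Qed.

End Coupling.

(** * Equivalence of the matrix inequalities and the sum of squares program *)

Theorem theorem10 (R : realType) (n m N : nat)
    (n_gt0 : (0 < n)%N) (m_gt0 : (0 < m)%N) (N_gt0 : (0 < N)%N)
    (A : 'M[R]_n) (B : 'M[R]_(n, m)) (J : 'I_N -> 'M[R]_n)
    (Tmin Tmax : R) (Tmin_gt0 : 0 < Tmin) (Tmin_le_Tmax : Tmin <= Tmax) :
  (exists (P : 'I_N -> 'M[R]_(n + m)) (K : 'I_N -> 'M[R]_(m, n + m))
          (Pi : 'M[R]_N) (eps : R),
     let Jbar i := Jbar0 m (J i) + Jbar1 R n m *m K i in
     [/\ forall i, posdefmx (P i),
         col_stochastic Pi,
         0 < eps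
       & forall (i : 'I_N) (theta : R), Tmin <= theta <= Tmax ->
         negsemidefmx
           ((Jbar i)^T *m expmx (theta *: (Abar A B)^T)
              *m (\sum_(j < N) Pi j i *: P j)
              *m expmx (theta *: Abar A B) *m Jbar i
            - P i + eps%:M)])
  <->
  (exists (eps : R) (d : nat), 0 < eps /\
   exists (S Gamma Delta : 'I_N -> 'M[{poly R}]_(n + m))
          (P : 'I_N -> 'M[R]_(n + m)) (U : 'I_N -> 'M[R]_(m, n + m))
          (Pi : 'M[R]_N),
     let Abarp := constpmx (Abar A B) in
     let M i := constpmx (Jbar0 m (J i) *m P i + Jbar1 R n m *m U i) in
     [/\ forall i, [/\ (S i)^T = S i, (Gamma i)^T = Gamma i,
                       (Delta i)^T = Delta i & (P i)^T = P i],
         forall i, [/\ degpmx_le (2 * d) (S i), degpmx_le (2 * d) (Gamma i)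
                     & degpmx_le (2 * d) (Delta i)],
         col_stochastic Pi
       & forall i,
         [/\ SOSmx (Gamma i) /\ SOSmx (Delta i),
             SOSmx (constpmx (P i - eps%:M)),
             SOSmx (- derivpmx (S i) - (S i *m Abarp^T + Abarp *m S i)
                    - gpoly Tmax *: Gamma i),
             SOSmx (block_mx (constpmx (P i - eps%:M)) (M i)^T
                             (M i) (S i - hpoly Tmin Tmax *: Delta i))
           & SOSmx (constpmx (\mxdiag_(j < N) P j
                      - Vmx (n + m) Pi i *m evalpmx (S i) 0
                          *m (Vmx (n + m) Pi i)^T))]]).
Proof.
split.
  move=> [P [K [Pi [eps [P_pd Pi_st eps_gt0 lmi]]]]].
  (* From (a) to (b). [sqn (P i *m u)] is at most [b * sqn u] for every [i], so a congruence by the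
     inverse of [P i] turns the margin [eps] into at least [c = eps / b]. *)
  pose b := 1 + \sum_i l1 ((P i)^T *m P i).
  have b_gt0 : 0 < b by rewrite ltr_wpDr // sumr_ge0 // => i _; exact: l1_ge0.
  pose c := eps / b; have c_gt0 : 0 < c by rewrite divr_gt0.
  have c2_gt0 : 0 < c / 2 by rewrite divr_gt0.
  pose Pt i := invmx (P i); pose U i := K i *m Pt i.
  have Pt_pd i : posdefmx (Pt i) := posdefmx_inv (P_pd i).
  pose G t := expmx (t *: Abar A B).
  pose Q i := \sum_(j < N) Pi j i *: P j.
  pose Jb i := Jbar0 m (J i) + Jbar1 R n m *m K i.
  pose M i := Jbar0 m (J i) *m Pt i + Jbar1 R n m *m U i.
  have Q_pd i : posdefmx (Q i) by exact: posdefmx_convex.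
  have ME i : M i = Jb i *m Pt i by rewrite /M /Jb /U mulmxDl mulmxA.
  have M_le i t : Tmin <= t <= Tmax -> forall v,
      qf ((G t)^T *m Q i *m G t) (M i *m v) <= qf (Pt i) v - c * sqn v.
    move=> t_bd v; have [_ /(_ (Pt i *m v))] := lmi i t t_bd.
    rewrite -[X in X <= 0]/(qf _ _) expmx_tr qf_lmi -/(G t) -/(Q i) -/(Jb i).
    have -> : qf (P i) (Pt i *m v) = qf (Pt i) v.
      have [Pt_sym _] := Pt_pd i.
      by rewrite -qf_congr Pt_sym mulVmx ?posdefmx_unit // mul1mx.
    rewrite mulmxA -ME => lmi_v.
    suff : c * sqn v <= eps * sqn (Pt i *m v) by lra.
    have {1}-> : v = P i *m (Pt i *m v).
      by rewrite mulmxA mulmxV ?posdefmx_unit // mul1mx.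
    rewrite /c -mulrA ler_wpM2l ?(ltW eps_gt0) // mulrC ler_pdivrMr // mulrC.
    rewrite (le_trans (sqn_mulmx_le _ _)) // ler_wpM2r ?sqn_ge0 //.
    rewrite /b (bigD1 i) //= addrCA lerDl addr_ge0 // sumr_ge0 // => j _.
    exact: l1_ge0.
  (* Half of the margin [c] becomes the scalar [eps] of (b); the other half pays for a contraction
     factor below 1. *)
  pose Pe i := Pt i - (c / 2)%:M.
  have X_ge0 i t v : 0 <= qf ((G t)^T *m Q i *m G t) v.
    by rewrite qf_congr posdefmx_qf.
  have Pe_pd i : posdefmx (Pe i).
    have [Pt_sym _] := Pt_pd i.
    apply: (@posdefmx_le _ _ _ (c / 2)) => // [|v].
      by rewrite linearB /= Pt_sym tr_scalar_mx.
    have := M_le i Tmin _ v; rewrite lexx Tmin_le_Tmax => /(_ isT).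
    have := X_ge0 i Tmin (M i *m v).
    by rewrite /Pe qfB qf_scalar; lra.
  have cert i : exists S Gamma Delta : 'M[{poly R}]_(n + m),
      [/\ S^T = S /\ evalpmx S 0 = invmx (Q i), SOSmx Gamma, SOSmx Delta,
          SOSmx (- derivpmx S - (S *m (constpmx (Abar A B))^T
                 + constpmx (Abar A B) *m S) - gpoly Tmax *: Gamma)
        & SOSmx (block_mx (constpmx (Pe i)) (constpmx (M i))^T
                    (constpmx (M i)) (S - hpoly Tmin Tmax *: Delta))].
    have l_gt0 : 0 < l1 (Pt i) + 1 + c by have := l1_ge0 (Pt i); lra.
    (* Chosen so that [h] times the form of [Pt i] is at most [c / 2 * sqn v]; this yields the
       inequality with [kappa = 1 - h] and [Pe i]. *)
    pose h := c / 2 / (l1 (Pt i) + 1 + c).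
    have h_gt0 : 0 < h by rewrite divr_gt0.
    have hE : h * (l1 (Pt i) + 1 + c) = c / 2 by rewrite divfK // gt_eqF.
    have h_lt1 : h < 1.
      by rewrite ltr_pdivrMr // mul1r; have := l1_ge0 (Pt i); lra.
    clearbody h; have h_ge0 := ltW h_gt0.
    apply: (@certificate_of_lmi _ _ _ _ _ _ _ _ (1 - h)) => //.
    - exact: ltW.
    - by rewrite subr_gt0 h_lt1 ltrBlDr ltrDl.
    move=> t t_bd v; apply: le_trans (M_le i t t_bd v) _.
    rewrite /Pe qfB qf_scalar.
    have v_ge0 := sqn_ge0 v.
    have h1 := ler_wpM2l h_ge0 (qf_le_l1 (Pt i) v).
    have h2 : h * (l1 (Pt i) * sqn v) + h * sqn v + h * c * sqn v =
        c / 2 * sqn v by rewrite -hE; ring.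
    have h3 := mulr_ge0 h_ge0 v_ge0.
    have h4 := mulr_ge0 (mulr_ge0 h_ge0 (ltW c_gt0)) v_ge0.
    lra.
  have [S /choice [Gamma /choice [Delta {}cert]]] := choice cert.
  have [dS dS_le] := choice (fun i => degpmx_le_exists (S i)).
  have [dG dG_le] := choice (fun i => degpmx_le_exists (Gamma i)).
  have [dD dD_le] := choice (fun i => degpmx_le_exists (Delta i)).
  pose d := (\sum_i (dS i + dG i + dD i))%N.
  have d_ge i : (dS i + dG i + dD i <= 2 * d)%N.
    rewrite mul2n -addnn (leq_trans _ (leq_addr _ _)) //.
    by rewrite /d (bigD1 i) //= leq_addr.
  exists (c / 2), d; split=> //; exists S, Gamma, Delta, Pt, U, Pi.
  move=> Abarp Mp; split=> // i; have [[S_sym S0] G_sos D_sos flow blk] := cert i.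
  - by split=> //; [exact: SOSmx_sym | exact: SOSmx_sym | have [] := Pt_pd i].
  - split; [apply: dS_le | apply: dG_le | apply: dD_le];
      apply: leq_trans (d_ge i); lia.
  split=> //; first exact: SOSmx_const_posdef (Pe_pd i).
  rewrite S0; have := coupling_SOS i Pi_st Pt_pd.
  have -> // : \sum_j Pi j i *: invmx (Pt j) = Q i.
  by apply: eq_bigr => j _; rewrite /Pt invmxK.
move=> [eps [d [eps_gt0 [S [Gamma [Delta [P [U [Pi [sym _ Pi_st sos]]]]]]]]]].
(* From (b) to (a). The matrices of (a) are the inverses [Pt i], and the gains are recovered as
   [K i = U i *m Pt i]. *)
have P_sym i : (P i)^T = P i by have [] := sym i.
have P_ge i v : eps * sqn v <= qf (P i) v.
  have [_ P_sos _ _ _] := sos i; have := SOSmx_eval 0 v P_sos.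
  by rewrite evalpmx_const qfB qf_scalar subr_ge0.
have P_pd i : posdefmx (P i) by apply: posdefmx_le (P_sym i) eps_gt0 (P_ge i).
pose Pt i := invmx (P i); pose K i := U i *m Pt i.
have Pt_pd i : posdefmx (Pt i) := posdefmx_inv (P_pd i).
pose b := 1 + \sum_i l1 ((P i)^T *m P i).
have b_gt0 : 0 < b by rewrite ltr_wpDr // sumr_ge0 // => i _; exact: l1_ge0.
pose Q i := \sum_(j < N) Pi j i *: Pt j.
have Q_pd i : posdefmx (Q i) by exact: posdefmx_convex.
have [Q_sym Pt_sym] : (forall i, (Q i)^T = Q i) /\ (forall i, (Pt i)^T = Pt i).
  by split=> i; [have [] := Q_pd i | have [] := Pt_pd i].
exists Pt, K, Pi, (eps / b) => Jb; split=> //; first by rewrite divr_gt0.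
move=> i t t_bd; rewrite expmx_tr -/(Q i); split.
  rewrite linearD linearB /= Pt_sym tr_scalar_mx !trmx_mul !trmxK Q_sym.
  by rewrite !mulmxA.
move=> y; rewrite -[X in X <= 0]/(qf _ _) qf_lmi.
(* The certificate bounds the form at [M v], which equals [Jb i *m y] for this [v]; its margin
   [eps * sqn v] dominates [eps / b * sqn y] because [y = P i *m v]. *)
pose v := Pt i *m y.
have yE : y = P i *m v by rewrite mulmxA mulmxV ?posdefmx_unit // mul1mx.
pose M := Jbar0 m (J i) *m P i + Jbar1 R n m *m U i.
have ME : M = Jb i *m P i.
  by rewrite /M /Jb mulmxDl -!mulmxA mulVmx ?posdefmx_unit // mulmx1.
have [[G_sos D_sos] _ flow blk coup] := sos i.
have := lmi_of_certificate (ltW Tmin_gt0) (Q_sym i) G_sos D_sos flow blk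
  (coupling_le Pi_st P_pd coup) t_bd v.
rewrite qfB qf_scalar -/M ME -(mulmxA (Jb i)) -yE.
have -> : qf (Pt i) y = qf (P i) v.
  by rewrite yE -qf_congr P_sym mulmxV ?posdefmx_unit // mul1mx.
suff : eps / b * sqn y <= eps * sqn v by lra.
rewrite yE -mulrA ler_wpM2l ?(ltW eps_gt0) // mulrC ler_pdivrMr // mulrC.
rewrite (le_trans (sqn_mulmx_le _ _)) // ler_wpM2r ?sqn_ge0 //.
rewrite /b (bigD1 i) //= addrCA lerDl addr_ge0 // sumr_ge0 // => j _.
exact: l1_ge0.
Qed.
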